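(* Let $n\ge2$ and let $s>1$ be odd. Then there exists neither a translation invariant function nor a bounded measurable function $\alpha\colon\mathcal K^n\to\mathbb T^s$ such that $$\int_{\mathcal E_1^n}\alpha(K\cap E)\,\mu_1^n(dE)=\Phi_{n-1,0,s}(K)$$ for all $K\in\mathcal K^n$.
   Context: $\mathcal K^n$ is the set of convex bodies (compact convex subsets, including $\emptyset$) of $\mathbb R^n$, with the Borel $\sigma$-algebra of the Hausdorff metric ($\emptyset$ being an isolated point). $\mathbb T^s$ is the space of symmetric tensors of rank $s$ over $\mathbb R^n$. Translation invariant means $\alpha(M+x)=\alpha(M)$ for all $M\in\mathcal K^n$, $x\in\mathbb R^n$. The integral identity is understood coordinate-wise and includes the requirement that $E\mapsto\alpha(K\cap E)$ be $\mu_1^n$-integrable. $\kappa_m$ and $\omega_m$ are the volume and surface area of the unit ball $B^m$ in $\mathbb R^m$. $\mathcal E^n_1$ is the space of affine lines in $\mathbb R^n$, and $\mu^n_1$ is the motion invariant measure on it normalized by $\mu_1^n(\{E: E\cap B^n\ne\emptyset\})=\kappa_{n-1}$. For $x\in\mathbb R^n$, $x^p$ is the symmetric tensor $x^p(z_1,\dots,z_p)=\prod_i\langle x,z_i\rangle$. Support measures: for non-empty $K\in\mathcal K^n$ let $p(K,x)$ be the metric projection of $x$ onto $K$ and $u(K,x)=(x-p(K,x))/\|x-p(K,x)\|$ for $x\notin K$. The measures $\Lambda_0(K,\cdot),\dots,\Lambda_{n-1}(K,\cdot)$ on $\mathbb R^n\times S^{n-1}$ are defined by $$\lambda(\{x\in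 (K+\epsilon B^n)\setminus K:(p(K,x),u(K,x))\in A\})=\sum_{k=0}^{n-1}\epsilon^{n-k}\kappa_{n-k}\Lambda_k(K,A)$$ for all $\epsilon>0$ and Borel $A$, where $\lambda$ is Lebesgue measure; they are zero if $K=\emptyset$. Surface tensors: $\Phi_{n-1,0,s}(K)=\frac{\omega_1}{s!\,\omega_{1+s}}\int_{\mathbb R^n\times S^{n-1}}u^s\,\Lambda_{n-1}(K,d(x,u))$, and $\Phi_{n-1,0,s}(\emptyset)=0$. *)

(* Defs.v *)
From HB Require Import structures.
From mathcomp Require Import all_boot all_order all_algebra all_fingroup.
From mathcomp Require Import all_classical all_reals all_analysis.

Set Implicit Arguments.
Unset Strict Implicit.
Unset Printing Implicit Defensive.

Import Order.TTheory GRing.Theory Num.Theory.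
Import numFieldNormedType.Exports.

Local Open Scope classical_set_scope.
Local Open Scope convex_scope.
Local Open Scope ring_scope.

(* The library norm on ['rV[R]_n] is the sup norm; it induces the usual
   topology, but all metric notions below use the Euclidean norm [enorm]. *)
Definition dot (R : realType) n (x y : 'rV[R]_n) : R :=
  \sum_(i < n) x 0 i * y 0 i.
Definition enorm (R : realType) n (x : 'rV[R]_n) : R := Num.sqrt (dot x x).
Definition eball (R : realType) n (r : R) : set 'rV[R]_n :=
  [set x | enorm x <= r].
Definition sphere (R : realType) n : set 'rV[R]_n := [set x | enorm x = 1].

Notation borel T := (g_sigma_algebraType (@open T)).

(* Lebesgue measure, given on Borel sets by iterated integration over the
   coordinates; its value on other sets is irrelevant. *)
Fixpoint lebesgueN (R : realType) n : set 'rV[R]_n -> \bar R :=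
  match n with
  | 0 => fun A => (\1_A (0 : 'rV[R]_0))%:E
  | n'.+1 => fun A => (\int[@lebesgue_measure R]_t
      lebesgueN [set y : 'rV[R]_n' | A (row_mx (const_mx t : 'rV[R]_1) y)])%E
  end.

Definition kappa (R : realType) m : R := fine (lebesgueN (@eball R m 1)).
(* The surface area of the unit ball of R^m is m times its volume. *)
Definition omega (R : realType) m : R := m%:R * kappa R m.

Record convex_body (R : realType) n := ConvexBody {
  body_set :> set 'rV[R]_n ;
  body_compact : compact body_set ;
  body_convex : convex_set (body_set : set (convex_lmodType 'rV[R]_n)) }.

Section convex_bodies.
Variables (R : realType) (n : nat).
Implicit Types K L : convex_body R n.

Lemma empty_body_compact : compact (set0 : set 'rV[R]_n).
Proof. exact: compact0. Qed.

Lemma empty_body_convex :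
  convex_set (set0 : set (convex_lmodType 'rV[R]_n)).
Proof. by move=> x y l; rewrite inE. Qed.

Definition empty_body : convex_body R n :=
  ConvexBody empty_body_compact empty_body_convex.

HB.instance Definition _ := gen_eqMixin (convex_body R n).
HB.instance Definition _ := gen_choiceMixin (convex_body R n).
HB.instance Definition _ := isPointed.Build (convex_body R n) empty_body.

Definition mink_sum (A B : set 'rV[R]_n) : set 'rV[R]_n :=
  [set a + b | a in A & b in B].

(* Infinite when exactly one of the two bodies is empty, so that the empty set
   is an isolated point. *)
Definition hausdorff_dist K L : \bar R :=
  ereal_inf [set e%:E | e in [set e : R | [/\ 0 <= e,
    K `<=` mink_sum L (eball e) & L `<=` mink_sum K (eball e)]]].

Definition hausdorff_open (U : set (convex_body R n)) : Prop :=
  forall K, U K -> exists2 e : R, 0 < e &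
    forall L, (hausdorff_dist K L < e%:E)%E -> U L.

Lemma translate_compact K (x : 'rV[R]_n) :
  compact [set y + x | y in (K : set 'rV[R]_n)].
Proof.
apply: continuous_compact; last exact: body_compact.
apply: continuous_subspaceT => y.
have := @cvgD R 'rV[R]_n _ (nbhs y) _ id (cst x) y x.
by apply; [exact: cvg_id|exact: cvg_cst].
Qed.

Lemma translate_convex K (x : 'rV[R]_n) :
  convex_set ([set y + x | y in (K : set _)] : set (convex_lmodType 'rV[R]_n)).
Proof.
move=> a b l; rewrite !inE => -[a' Ka' <-] [b' Kb' <-].
have := @body_convex _ _ K a' b' l (mem_set Ka') (mem_set Kb').
rewrite inE => Kab; exists ((a' : convex_lmodType 'rV[R]_n) <| l |> b') => //.
rewrite /conv/= !scalerDr addrACA -scalerDl; congr (_ + _).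
by rewrite [X in X *: _](_ : _ = 1) ?scale1r// addrC subrK.
Qed.

Definition translate K (x : 'rV[R]_n) : convex_body R n :=
  ConvexBody (@translate_compact K x) (@translate_convex K x).

Definition metric_proj K (x : 'rV[R]_n) : 'rV[R]_n :=
  xget 0 [set y | body_set K y /\
    forall z, body_set K z -> enorm (x - y) <= enorm (x - z)].

Definition normal_dir K (x : 'rV[R]_n) : 'rV[R]_n :=
  (enorm (x - metric_proj K x))^-1 *: (x - metric_proj K x).

Definition local_parallel_set K (eps : R) (A : set ('rV[R]_n * 'rV[R]_n)) :
    set 'rV[R]_n :=
  [set x | (mink_sum K (eball eps) `\` K) x /\
           A (metric_proj K x, normal_dir K x)].

(* Measures on R^n x S^{n-1} are rendered as Borel measures on R^n x R^n of
   which only the values on subsets of [setT `*` sphere] are used.  The local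
   Steiner formula determines these values. *)
Definition is_support_measures
    (Lam : convex_body R n -> 'I_n ->
           {measure set (borel ('rV[R]_n * 'rV[R]_n)%type) -> \bar R}) : Prop :=
  forall K (A : set (borel ('rV[R]_n * 'rV[R]_n)%type)),
    measurable A -> A `<=` [set: 'rV[R]_n] `*` @sphere R n ->
    (K !=set0 -> forall eps : R, 0 < eps ->
      lebesgueN (local_parallel_set K eps A) =
      (\sum_(k < n) (eps ^+ (n - k) * kappa R (n - k))%:E * Lam K k A)%E) /\
    (~ (K !=set0) -> forall k, Lam K k A = 0%E).

End convex_bodies.

Notation body_borel R n := (g_sigma_algebraType (@hausdorff_open R n)).

Definition affine_line (R : realType) n (p u : 'rV[R]_n) : set 'rV[R]_n :=
  [set p + t *: u | t in [set: R]].

(* Ambient dimension [n.+1]: there are no lines in R^0. *)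
Record line (R : realType) n := Line {
  line_set :> set 'rV[R]_n.+1 ;
  line_setP : exists p u, u != 0 /\ line_set = affine_line p u }.

Section lines.
Variables (R : realType) (n : nat).
Implicit Types (K : convex_body R n.+1) (E : line R n).

Lemma coord_line_setP :
  exists p u : 'rV[R]_n.+1, u != 0 /\
    affine_line 0 (const_mx 1) = affine_line p u.
Proof.
exists 0, (const_mx 1); split => //.
by apply/eqP => /rowP/(_ 0); rewrite !mxE; exact/eqP/oner_neq0.
Qed.

HB.instance Definition _ := gen_eqMixin (line R n).
HB.instance Definition _ := gen_choiceMixin (line R n).
HB.instance Definition _ := isPointed.Build (line R n) (Line coord_line_setP).

(* The quotient topology of the parametrization of lines by a point and a
   nonzero direction. *)
Definition line_open (U : set (line R n)) : Prop :=
  open [set q : 'rV[R]_n.+1 * 'rV[R]_n.+1 | q.2 != 0 /\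
    exists2 E, U E & E = affine_line q.1 q.2 :> set _].

Lemma line_closed E : closed (E : set _).
Proof.
have [p [u [u0 ->]]] := line_setP E.
have [i ui0] : exists i, u 0 i != 0.
  apply/existsP; rewrite -negb_forall; apply: contraNN u0 => /forallP u0.
  by apply/eqP/rowP => i; rewrite mxE; exact/eqP.
pose f (x : 'rV[R]_n.+1) := (x - p) - (((x - p) 0 i) / u 0 i) *: u.
have -> : affine_line p u = f @^-1` [set 0].
  apply/seteqP; split => [_ [t _ <-]|x /= fx0].
    by rewrite /f/= [p + _]addrC addrK mxE mulfK// subrr.
  exists ((x - p) 0 i / u 0 i) => //.
  by move/eqP : fx0; rewrite subr_eq0 => /eqP <-; rewrite addrC subrK.
apply: preimage_closed.
  have cxp (x : 'rV[R]_n.+1) : (y - p) @[y --> x] --> (x - p).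
    have := @cvgB R 'rV[R]_n.+1 _ (nbhs x) _ id (cst p) x p.
    by apply; [exact: cvg_id|exact: cvg_cst].
  move=> x _; have := @cvgB R 'rV[R]_n.+1 _ (nbhs x) _ (fun y => y - p)
    (fun y => ((y - p) 0 i / u 0 i) *: u) (x - p) (((x - p) 0 i / u 0 i) *: u).
  apply; first exact: cxp.
  apply: cvgZr_tmp; apply: cvgMr_tmp.
  exact: (cvg_comp _ _ (cxp x) (@coord_continuous _ _ _ 0 i _)).
exact/accessible_closed_set1/hausdorff_accessible/norm_hausdorff.
Qed.

Lemma cap_line_compact K E : compact (K `&` E).
Proof.
exact: compact_closedI (@body_compact _ _ K) (@line_closed E).
Qed.

Lemma cap_line_convex K E :
  convex_set (K `&` E : set (convex_lmodType 'rV[R]_n.+1)).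
Proof.
move=> x y l; rewrite !inE => -[Kx Ex] [Ky Ey].
split.
  by have := @body_convex _ _ K x y l (mem_set Kx) (mem_set Ky); rewrite inE.
have [p [u [_ Epu]]] := line_setP E.
move: Ex Ey; rewrite Epu => -[a _ <-] [b _ <-].
exists (l%:num * a + (1 - l%:num) * b) => //.
rewrite /conv/= !scalerDr addrACA !scalerA -!scalerDl; congr (_ + _).
by rewrite [X in X *: p](_ : _ = 1) ?scale1r// addrC subrK.
Qed.

Definition cap_line K E : convex_body R n.+1 :=
  ConvexBody (@cap_line_compact K E) (@cap_line_convex K E).

Lemma move_line_setP (Q : 'M[R]_n.+1) (v : 'rV[R]_n.+1) E :
  Q *m Q^T = 1%:M -> exists p u, u != 0 /\
    [set x *m Q + v | x in (E : set _)] = affine_line p u.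
Proof.
move=> QQ; have [p [u [u0 ->]]] := line_setP E.
exists (p *m Q + v), (u *m Q); split.
  by apply: contraNN u0 => /eqP uQ; rewrite -(mulmx1 u) -QQ mulmxA uQ mul0mx.
apply/seteqP; split => [_ [_ [t _ <-] <-]|_ [t _ <-]].
  by exists t => //; rewrite mulmxDl scalemxAl addrAC.
by exists (p + t *: u); [exists t|rewrite mulmxDl scalemxAl addrAC].
Qed.

(* The image of [E] under the motion [x |-> x *m Q + v]. *)
Definition move_line (Q : 'M[R]_n.+1) (v : 'rV[R]_n.+1)
    (QQ : Q *m Q^T = 1%:M) E : line R n :=
  Line (move_line_setP v E QQ).

End lines.

Notation line_borel R n := (g_sigma_algebraType (@line_open R n)).

Definition is_invariant_line_measure (R : realType) n
    (mu : {measure set (line_borel R n) -> \bar R}) : Prop :=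
  (forall (Q : 'M[R]_n.+1) (v : 'rV[R]_n.+1) (QQ : Q *m Q^T = 1%:M)
     (B : set (line_borel R n)),
     measurable B -> mu (move_line v QQ @^-1` B) = mu B) /\
  mu [set E : line R n | (E `&` eball 1) !=set0] = (kappa R n)%:E.

(* Symmetric tensors of rank [s] over R^n are symmetric [s]-linear functionals,
   determined by their values on the standard basis ([tensor_coord] below). *)
Record symtensor (R : realType) n s := SymTensor {
  tensor_fun :> ('I_s -> 'rV[R]_n) -> R ;
  tensor_multilinear : forall i z a x y,
    tensor_fun [eta z with i |-> a *: x + y] =
    a * tensor_fun [eta z with i |-> x] + tensor_fun [eta z with i |-> y] ;
  tensor_sym : forall (p : 'S_s) z, tensor_fun (z \o p) = tensor_fun z }.

Section tensors.
Variables (R : realType) (n s : nat).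

Definition tensor_coord (T : symtensor R n s) (i : 'I_s -> 'I_n) : R :=
  T (fun j => 'e_(i j)).

Lemma tensor_pow_multilinear (x : 'rV[R]_n) (i : 'I_s) z (a : R) y y' :
  \prod_j dot x ([eta z with i |-> a *: y + y'] j) =
  a * \prod_j dot x ([eta z with i |-> y] j)
  + \prod_j dot x ([eta z with i |-> y'] j).
Proof.
have E w : \prod_j dot x ([eta z with i |-> w] j) =
           dot x w * \prod_(j | j != i) dot x (z j).
  rewrite (bigD1 i)//= eqxx; congr (_ * _).
  by apply: eq_bigr => j /negbTE ->.
rewrite !E mulrA -mulrDl; congr (_ * _).
rewrite /dot mulr_sumr -big_split/=; apply: eq_bigr => k _.
by rewrite !mxE mulrDr mulrCA.
Qed.

Lemma tensor_pow_sym (x : 'rV[R]_n) (p : 'S_s) (z : 'I_s -> 'rV[R]_n) :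
  \prod_j dot x ((z \o p) j) = \prod_j dot x (z j).
Proof. by rewrite [RHS](reindex_inj (@perm_inj _ p)). Qed.

Definition tensor_pow (x : 'rV[R]_n) : symtensor R n s :=
  @SymTensor R n s (fun z => \prod_j dot x (z j))
    (tensor_pow_multilinear x) (tensor_pow_sym x).

Definition translation_invariant (alpha : convex_body R n -> symtensor R n s) :=
  forall K x, alpha (translate K x) = alpha K.

(* T^s is finite dimensional, so boundedness and Borel measurability can be
   tested coordinatewise. *)
Definition bounded_tensor_fun (alpha : convex_body R n -> symtensor R n s) :=
  exists C : R, forall K i, `|tensor_coord (alpha K) i| <= C.

Definition measurable_tensor_fun
    (alpha : convex_body R n -> symtensor R n s) :=
  forall i, measurable_fun [set: body_borel R n]
    (fun K : body_borel R n => tensor_coord (alpha K) i).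

End tensors.

(* Coordinates of the surface tensor Phi_{n,0,s} in R^{n+1}; [ord_max] is the
   index n of the top support measure. *)
Definition surface_tensor_coord (R : realType) n s
    (Lam : convex_body R n.+1 -> 'I_n.+1 ->
       {measure set (borel ('rV[R]_n.+1 * 'rV[R]_n.+1)%type) -> \bar R})
    (K : convex_body R n.+1) (i : 'I_s -> 'I_n.+1) : R :=
  omega R 1 / (s`!%:R * omega R (1 + s)) *
  \int[Lam K ord_max]_(xu in [set: 'rV[R]_n.+1] `*` @sphere R n.+1)
     tensor_coord (tensor_pow s xu.2) i.

Definition surface_crofton (R : realType) n s
    (mu : {measure set (line_borel R n) -> \bar R})
    (Lam : convex_body R n.+1 -> 'I_n.+1 ->
       {measure set (borel ('rV[R]_n.+1 * 'rV[R]_n.+1)%type) -> \bar R})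
    (alpha : convex_body R n.+1 -> symtensor R n.+1 s) : Prop :=
  forall K (i : 'I_s -> 'I_n.+1),
    mu.-integrable [set: line_borel R n]
      (fun E : line_borel R n => (tensor_coord (alpha (cap_line K E)) i)%:E) /\
    (\int[mu]_E (tensor_coord (alpha (cap_line K E)) i)%:E)%E =
      (surface_tensor_coord Lam K i)%:E.

(* Main.v *)
(** Let K be the product of an isosceles right triangle (in the first two
    coordinates) and a cube.  Of all its facet normals u, only the normal of the
    hypotenuse has u_1 u_0^(s-1) <> 0, because s > 1; as s is odd, the
    corresponding coordinates of Phi(K + x) and Phi(- K + x) differ by at least a
    constant c > 0 independent of x.

    By motion invariance Phi(K + x) and Phi(- K + x) are the integrals of
    alpha((K cap E) + x) and alpha(- (K cap E) + x) over the lines E.  A segment is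
    centrally symmetric, so - (K cap E) is a translate of K cap E, and a translation
    invariant alpha would give c = 0.  If alpha is bounded and measurable, view it
    as a Borel function of the two end points of a segment, and average it over the
    translations by t e_j, 0 <= t <= r, successively for every coordinate j.  By
    Tonelli the averages have the same gap c, but a translation by y changes them
    by at most O(|y| / r), uniformly; r -> oo gives c = 0 again. *)

Require Import Defs.
From mathcomp Require Import all_boot all_order all_algebra.
From mathcomp Require Import all_classical all_reals all_analysis.
From mathcomp Require Import measurable_realfun ring lra.

Import Order.TTheory GRing.Theory Num.Theory.
Import numFieldNormedType.Exports.

Local Open Scope classical_set_scope.
Local Open Scope convex_scope.
Local Open Scope ring_scope.

Set Implicit Arguments.
Unset Strict Implicit.
Unset Printing Implicit Defensive.

(** * Boxes and Lebesgue measure *)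

(** The support measures are known only through the Steiner formula, and [lebesgueN] is an iterated
    integral of possibly nonmeasurable slices, so no facet measure is computed. The top support
    measure is the coefficient of the term linear in e, and two volume estimates by boxes suffice:
    normals for which the chosen coordinate has the wrong sign belong to points that project to a
    face of codimension two, whose parallel volume is O(e^2); over the hypotenuse a slab has volume
    at least a constant times e. In the bounded case the translation that carries the reflected
    chord to the chord depends on the line and cannot be moved out of the integral. This is why the
    gap is needed for every x: averages over fixed translations inherit it, and afterwards a
    translation bounded over all lines costs little, uniformly. The cost is multiplied by the total
    mass, hence the restriction to the lines that hit K; the other lines contribute alpha of the
    empty set to both integrals and cancel. Tonelli needs end points that depend measurably on the
    line, and thus a measurable orientation of lines. *)

Section le_integral_gen.
Context d (T : measurableType d) (R : realType).
Variable mu : {measure set T -> \bar R}.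
Local Open Scope ereal_scope.

(* No measurability is assumed: the slices integrated by [lebesgueN] may be
   arbitrary sets. *)
Lemma le_integral_nonmeasurable (f g : T -> \bar R) :
  (forall t, 0 <= f t) -> (forall t, f t <= g t) ->
  \int[mu]_t f t <= \int[mu]_t g t.
Proof.
move=> f0 fg.
have g0 t : 0 <= g t by exact: le_trans (f0 t) (fg t).
rewrite !ge0_integralTE//; apply: ereal_sup_le => _ [h hf <-].
by exists h => // t; exact: le_trans (hf t) (fg t).
Qed.

End le_integral_gen.

Section lebesgueN.
Variable R : realType.
Implicit Types n : nat.

Definition slice n (A : set 'rV[R]_n.+1) (t : R) : set 'rV[R]_n :=
  [set y | A (row_mx (const_mx t : 'rV[R]_1) y)].

Lemma lebesgueN_ge0 n (A : set 'rV[R]_n) : (0 <= lebesgueN A)%E.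
Proof.
elim: n A => [|n IH] A /=; first by rewrite lee_fin.
by apply: integral_ge0 => t _; exact: IH.
Qed.

Lemma le_lebesgueN n (A B : set 'rV[R]_n) :
  A `<=` B -> (lebesgueN A <= lebesgueN B)%E.
Proof.
elim: n A B => [|n IH] A B AB /=.
  rewrite lee_fin !indicE ler_nat.
  by case: (boolP (0 \in A)) => // /set_mem /AB /mem_set ->.
apply: le_integral_nonmeasurable => t; first exact: lebesgueN_ge0.
by apply: IH => y /=; exact: AB.
Qed.

Lemma lebesgueN0 n : lebesgueN (set0 : set 'rV[R]_n) = 0%E.
Proof.
elim: n => [|n IH] /=; first by rewrite indic0.
by rewrite integral0_eq// => t _; rewrite (_ : mkset _ = set0)// -subset0.
Qed.

Lemma integral_cst_itv (a b v : R) : a <= b -> 0 <= v ->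
  (\int[@lebesgue_measure R]_t (v * \1_`[a, b] t)%:E)%E = ((b - a) * v)%:E.
Proof.
move=> ab v0.
rewrite integralZl_indic//= ?integral_indic//= ?setIT ?lebesgue_measure_itv/=.
  rewrite lte_fin; case: ltP => [_|ba]; first by rewrite mulrC EFinM.
  by rewrite mule0 (_ : b = a) ?subrr ?mul0r//; apply/eqP; rewrite eq_le ba ab.
by move=> v_lt0; have := le_lt_trans v0 v_lt0; rewrite ltxx.
Qed.

Lemma lebesgueN_ge_slices n (A : set 'rV[R]_n.+1) (a b v : R) : a <= b ->
  0 <= v -> (forall t, a <= t <= b -> (v%:E <= lebesgueN (slice A t))%E) ->
  (((b - a) * v)%:E <= lebesgueN A)%E.
Proof.
move=> ab v0 H /=.
rewrite -integral_cst_itv//.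
apply: le_integral_nonmeasurable => t.
  by rewrite lee_fin mulr_ge0// indicE.
rewrite indicE; case: (boolP (t \in _)) => [|_].
  by rewrite inE/= in_itv/= mulr1; exact: H.
by rewrite mulr0 lebesgueN_ge0.
Qed.

Lemma lebesgueN_le_slices n (A : set 'rV[R]_n.+1) (a b v : R) : a <= b ->
  0 <= v -> (forall x, A x -> a <= x 0 0 <= b) ->
  (forall t, a <= t <= b -> (lebesgueN (slice A t) <= v%:E)%E) ->
  (lebesgueN A <= ((b - a) * v)%:E)%E.
Proof.
move=> ab v0 Aab H /=.
rewrite -integral_cst_itv//.
apply: le_integral_nonmeasurable => t; first exact: lebesgueN_ge0.
rewrite indicE; case: (boolP (t \in _)) => [|tab].
  by rewrite inE/= in_itv/= mulr1; exact: H.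
rewrite mulr0 (_ : mkset _ = set0) ?lebesgueN0// -subset0 => y /= /Aab.
have -> : row_mx (const_mx t : 'rV[R]_1) y 0 0 = t.
  by rewrite (_ : 0 = lshift n 0 :> 'I_(1 + n)) ?row_mxEl ?mxE//; exact/val_inj.
by move=> tab'; move/negP : tab; apply; rewrite inE/= in_itv.
Qed.

Definition box n (l r : 'I_n -> R) : set 'rV[R]_n :=
  [set x | forall j, l j <= x 0 j <= r j].

Lemma row_mx_lift0 n t (y : 'rV[R]_n) (j : 'I_n) :
  row_mx (const_mx t : 'rV[R]_1) y 0 (lift ord0 j) = y 0 j.
Proof.
by rewrite (_ : lift ord0 j = rshift 1 j) ?row_mxEr//; exact/val_inj.
Qed.

Lemma row_mx_ord0 n t (y : 'rV[R]_n) :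
  row_mx (const_mx t : 'rV[R]_1) y 0 ord0 = t.
Proof.
by rewrite (_ : ord0 = lshift n 0 :> 'I_(1 + n)) ?row_mxEl ?mxE//; exact/val_inj.
Qed.

Lemma slice_box n (l r : 'I_n.+1 -> R) t : l ord0 <= t <= r ord0 ->
  slice (box l r) t = box (l \o lift ord0) (r \o lift ord0).
Proof.
move=> lr; apply/seteqP; split => y /= yA j.
  by have := yA (lift ord0 j); rewrite row_mx_lift0.
case: (unliftP ord0 j) => [k ->|->]; first by rewrite row_mx_lift0; exact: yA.
by rewrite row_mx_ord0.
Qed.

Lemma lebesgueN_box n (l r : 'I_n -> R) : (forall j, l j <= r j) ->
  lebesgueN (box l r) = (\prod_j (r j - l j))%:E.
Proof.
elim: n l r => [|n IH] l r lr.
  by rewrite big_ord0 /= indicE mem_set//= => -[].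
have v0 : 0 <= \prod_j (r (lift ord0 j) - l (lift ord0 j)).
  by apply: prodr_ge0 => j _; rewrite subr_ge0.
have E t : l ord0 <= t <= r ord0 -> lebesgueN (slice (box l r) t) =
    (\prod_j (r (lift ord0 j) - l (lift ord0 j)))%:E.
  by move=> lt; rewrite slice_box// IH// => j; exact: lr.
rewrite big_ord_recl; apply/eqP; rewrite eq_le; apply/andP; split.
  by apply: lebesgueN_le_slices => // t /E ->.
by apply: lebesgueN_ge_slices => // t /E ->.
Qed.

Lemma lebesgueN_le_box n (A : set 'rV[R]_n) (l r : 'I_n -> R) :
  (forall j, l j <= r j) -> A `<=` box l r ->
  (lebesgueN A <= (\prod_j (r j - l j))%:E)%E.
Proof. by move=> lr AB; rewrite -lebesgueN_box//; exact: le_lebesgueN. Qed.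

End lebesgueN.

Lemma sigma_algebra_measurable_fun (R : realType) (T : pointedType)
    (G : set (set T)) (f : T -> R) :
  (forall x, G (f @^-1` `]x, +oo[)) ->
  measurable_fun [set: g_sigma_algebraType G] (f : g_sigma_algebraType G -> R).
Proof.
move=> Gf; apply: (measurability _ (RGenOInfty.measurableE R)) => //.
by move=> _ [_ [x ->] <-]; rewrite setTI; exact: sub_sigma_algebra.
Qed.

Section borel_pair.
Variables (R : realType) (n : nat).
Local Notation T := ('rV[R]_n * 'rV[R]_n)%type.

Lemma borel_closed (A : set (borel T)) : closed A -> measurable A.
Proof.
move=> cA; rewrite -(setCK A); apply: measurableC; apply: sub_sigma_algebra.
by rewrite openC.
Qed.

Lemma borel_continuous (f : T -> R) :
  continuous f -> measurable_fun [set: borel T] (f : borel T -> R).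
Proof.
move=> cf; apply: sigma_algebra_measurable_fun => x.
by apply: open_comp => [y _|]; [exact: cf|exact: interval_open].
Qed.

End borel_pair.

Section dot.
Variables (R : realType) (n : nat).
Implicit Types x y z : 'rV[R]_n.

Lemma dotC x y : dot x y = dot y x.
Proof. by apply: eq_bigr => i _; rewrite mulrC. Qed.

Lemma dotDr x y z : dot x (y + z) = dot x y + dot x z.
Proof. by rewrite -big_split; apply: eq_bigr => i _; rewrite mxE mulrDr. Qed.

Lemma dotZr a x y : dot x (a *: y) = a * dot x y.
Proof. by rewrite mulr_sumr; apply: eq_bigr => i _; rewrite mxE mulrCA. Qed.

Lemma dotNr x y : dot x (- y) = - dot x y.
Proof. by rewrite -scaleN1r dotZr mulN1r. Qed.

Lemma dotBr x y z : dot x (y - z) = dot x y - dot x z.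
Proof. by rewrite dotDr dotNr. Qed.

Lemma dotDl x y z : dot (x + y) z = dot x z + dot y z.
Proof. by rewrite dotC dotDr !(dotC z). Qed.

Lemma dotZl a x y : dot (a *: x) y = a * dot x y.
Proof. by rewrite dotC dotZr (dotC y). Qed.

Lemma dotNl x y : dot (- x) y = - dot x y.
Proof. by rewrite dotC dotNr (dotC y). Qed.

Lemma dotBl x y z : dot (x - y) z = dot x z - dot y z.
Proof. by rewrite dotDl dotNl. Qed.

Lemma dot_delta x (i : 'I_n) : dot x 'e_i = x 0 i.
Proof.
rewrite /dot (bigD1 i)//= !mxE !eqxx mulr1 big1 ?addr0// => j ji.
by rewrite !mxE (negbTE ji) andbF mulr0.
Qed.

Lemma dot_ge0 x : 0 <= dot x x.
Proof. by apply: sumr_ge0 => i _; rewrite -expr2 sqr_ge0. Qed.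

Lemma enorm_ge0 x : 0 <= enorm x.
Proof. exact: sqrtr_ge0. Qed.

Lemma enorm_sqr x : enorm x ^+ 2 = dot x x.
Proof. by rewrite sqr_sqrtr// dot_ge0. Qed.

Lemma coord_le_enorm x i : `|x 0 i| <= enorm x.
Proof.
rewrite -sqrtr_sqr ler_sqrt ?dot_ge0// /dot (bigD1 i)//= expr2 lerDl.
by apply: sumr_ge0 => j _; rewrite -expr2 sqr_ge0.
Qed.

Lemma enorm_le x e : 0 <= e -> (enorm x <= e) = (dot x x <= e ^+ 2).
Proof. by move=> e0; rewrite -enorm_sqr ler_sqr ?nnegrE ?enorm_ge0. Qed.

Lemma dot_eq0 x : dot x x <= 0 -> x = 0.
Proof.
move=> x0; apply/rowP => i; rewrite mxE; apply/eqP; rewrite -normr_le0.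
apply: le_trans (coord_le_enorm x i) _.
by rewrite enorm_le// expr0n.
Qed.

Lemma enorm_le_sum x (e : R) : 0 <= e -> (forall i, `|x 0 i| <= e) ->
  enorm x <= n%:R * e.
Proof.
move=> e0 H; rewrite enorm_le ?mulr_ge0//.
apply: (@le_trans _ _ (n%:R * e ^+ 2)).
  rewrite -[n in n%:R]card_ord mulr_natl -sumr_const; apply: ler_sum => i _.
  by rewrite -expr2 -real_normK ?num_real// ler_sqr ?nnegrE.
rewrite exprMn ler_wpM2r ?sqr_ge0// -natrX ler_nat.
by case: (posnP n) => [->//|n0]; rewrite -mulnn leq_pmulr.
Qed.

Lemma continuous_dot (T : topologicalType) (f g : T -> 'rV[R]_n) :
  continuous f -> continuous g -> continuous (fun t => dot (f t) (g t)).
Proof.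
move=> cf cg; rewrite /dot.
apply: (@continuous_big R^o 'I_n +%R 0 xpredT) => [|i _ t].
  exact: add_continuous.
apply: cvgM.
  exact: (cvg_comp _ _ (cf t) (@coord_continuous _ _ _ 0 i _)).
exact: (cvg_comp _ _ (cg t) (@coord_continuous _ _ _ 0 i _)).
Qed.

Lemma continuous_dotl y : continuous (fun x => dot x y).
Proof.
apply: (@continuous_dot _ id (cst y)) => x; first exact: cvg_id.
exact: cst_continuous.
Qed.

Lemma continuous_enorm : continuous (@enorm R n).
Proof.
move=> x; apply: continuous_comp; last exact: sqrt_continuous.
by apply: continuous_dot => z; exact: cvg_id.
Qed.

End dot.

(** [kappa] is a [fine], which would be 0 if the volume were infinite. So the ball is squeezed
    between two cubes: the outer one gives finiteness, the inner one, of half side 1 / (m + 1),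
    positivity. *)
Lemma kappa_gt0 (R : realType) m : 0 < kappa R m.
Proof.
rewrite /kappa; set v := lebesgueN _.
have v1 : (v <= (\prod_(j < m) (1 - -1))%:E)%E.
  apply: lebesgueN_le_box => [j|x /= x1 j]; first lra.
  by have := le_trans (coord_le_enorm x j) x1; rewrite ler_norml.
have [d d0 md] : exists2 d : R, 0 < d & m%:R * d <= 1.
  exists m.+1%:R^-1; first by rewrite invr_gt0.
  by rewrite ler_pdivrMr// mul1r ler_nat.
have v2 : ((\prod_(j < m) (d - - d))%:E <= v)%E.
  rewrite -(@lebesgueN_box R m (fun=> - d) (fun=> d)); last by move=> j; lra.
  apply: le_lebesgueN => x H; apply: le_trans (enorm_le_sum (ltW d0) _) md.
  by move=> i; rewrite ler_norml; exact: H.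
rewrite -lte_fin fineK.
  apply: lt_le_trans v2; rewrite lte_fin; apply: prodr_gt0 => j _; lra.
by rewrite ge0_fin_numE ?lebesgueN_ge0//; apply: le_lt_trans v1 (ltry _).
Qed.

(** * Metric projection and the Steiner polynomial *)

Section metric_projection.
Variables (R : realType) (n : nat).
Implicit Types K : convex_body R n.

Lemma dot_subZ (w v : 'rV[R]_n) t :
  dot (w - t *: v) (w - t *: v) = dot w w - 2 * t * dot w v + t ^+ 2 * dot v v.
Proof.
by rewrite dotBr !dotBl !dotZr !dotZl (dotC v w); ring.
Qed.

Lemma metric_projP K x : K !=set0 -> body_set K (metric_proj K x) /\
  forall z, body_set K z -> enorm (x - metric_proj K x) <= enorm (x - z).
Proof.
move=> K0; rewrite /metric_proj.
case: xgetP => [_ _ []//|H].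
have [|c cK cmin] := @compact_EVT_min _ R (fun z : 'rV[R]_n => enorm (x - z))
    _ K0 (@body_compact _ _ K).
  apply: continuous_subspaceT => z.
  have cz : (x - (y : 'rV[R]_n)) @[y --> z] --> (x - z).
    by have := @cvgB R 'rV[R]_n _ (nbhs z) _ (cst x) id x z; apply; [exact: cvg_cst|exact: cvg_id].
  exact: (cvg_comp _ _ cz (@continuous_enorm R n (x - z))).
exfalso; apply: (H c); split; first exact/set_mem.
by move=> z zK; apply: cmin; exact/mem_set.
Qed.

(** The variational inequality of the projection: by convexity the points t z + (1 - t) p compete
    with p, and the derivative of the squared distance at t = 0 cannot be negative. *)
Lemma metric_proj_dot K x z : body_set K z ->
  dot (x - metric_proj K x) (z - metric_proj K x) <= 0.
Proof.
move=> Kz; have [] := @metric_projP K x; first by exists z.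
set p := metric_proj K x => Kp pmin.
rewrite leNgt; apply/negP => a0; set a := dot _ _ in a0.
set b := dot (z - p) (z - p).
have b0 : 0 <= b by exact: dot_ge0.
have H (t : R) : 0 <= t <= 1 -> 2 * t * a <= t ^+ 2 * b.
  move=> /andP[t0 t1].
  have Kt : body_set K (t *: z + (1 - t) *: p).
    have [t' E] : exists t' : {i01 R}, t'%:num = t.
      by have := @Itv01 R t t0 t1; move=> i; exists (Itv01 t0 t1).
    have := @body_convex _ _ K z p t' (mem_set Kz) (mem_set Kp).
    by rewrite inE /conv/= E.
  have := pmin _ Kt; rewrite enorm_le ?enorm_ge0// enorm_sqr.
  have -> : x - (t *: z + (1 - t) *: p) = (x - p) - t *: (z - p).
    by apply/rowP => j; rewrite !mxE; ring.
  by rewrite dot_subZ -/a -/b; nra.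
(* Small enough that t b < a, while [H] would give 2 a <= t b. *)
pose t := Num.min 1 (a / (b + 1)).
have t0 : 0 < t by rewrite lt_min ltr01 divr_gt0// ltr_wpDl.
have t1 : t <= 1 by rewrite ge_min lexx.
have t2 : t * (b + 1) <= a by rewrite -ler_pdivlMr ?ltr_wpDl// ge_min lexx orbT.
have := H t; rewrite (ltW t0) t1 => /(_ isT); nra.
Qed.

(** Expanding |x - q|^2 around p, the hypothesis and the minimality of q leave |q - p|^2 <= 0. This
    identifies a projection from a guessed foot point. *)
Lemma metric_proj_eq K x p : body_set K p ->
  (forall z, body_set K z -> dot (x - p) (z - p) <= 0) -> metric_proj K x = p.
Proof.
move=> Kp H; have [] := @metric_projP K x; first by exists p.
set q := metric_proj K x => Kq /(_ _ Kp); rewrite enorm_le ?enorm_ge0// enorm_sqr.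
have := H _ Kq; have -> : x - q = (x - p) - 1 *: (q - p) by rewrite scale1r opprB addrA subrK.
rewrite dot_subZ => Hq H2.
by apply/eqP; rewrite -subr_eq0; apply/eqP/dot_eq0; lra.
Qed.

Lemma local_parallel_setP K e A x : 0 < e -> local_parallel_set K e A x ->
  A (metric_proj K x, normal_dir K x) /\
  body_set K (metric_proj K x) /\
  enorm (x - metric_proj K x) <= e /\ 0 < enorm (x - metric_proj K x) .
Proof.
move=> e0 [[[k Kk [b be kbx]] nKx] HA]; split => //.
have [Kp pmin] := @metric_projP K x (ex_intro _ k Kk).
split => //; split.
  by apply: le_trans (pmin _ Kk) _; rewrite -kbx addrC addKr.
rewrite lt_neqAle enorm_ge0 andbT eq_sym; apply/eqP => E.
apply: nKx; rewrite (_ : x = metric_proj K x)//; apply/eqP; rewrite -subr_eq0.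
by apply/eqP/dot_eq0; rewrite -enorm_sqr E expr0n.
Qed.

End metric_projection.

Section steiner_polynomial.
Variables (R : realType) (n : nat) (a : 'I_n.+1 -> R) (L : 'I_n.+1 -> \bar R).
Hypothesis a0 : forall k, 0 < a k.
Hypothesis L0 : forall k, (0 <= L k)%E.

(** The right-hand side of the local Steiner formula for one body and one Borel set: [a k] stands
    for the ball volume, [L k] for the k-th support measure, which a priori may be infinite. *)
Let P (e : R) : \bar R := (\sum_(k < n.+1) (e ^+ (n.+1 - k) * a k)%:E * L k)%E.

Lemma steiner_term_le (e : R) (k : 'I_n.+1) : 0 < e ->
  ((e ^+ (n.+1 - k) * a k)%:E * L k <= P e)%E.
Proof.
move=> e0; rewrite /P (bigD1 k)//= leeDl// sume_ge0// => j _.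
by rewrite mule_ge0// lee_fin mulr_ge0// ?exprn_ge0// ltW.
Qed.

(** All terms are nonnegative, so a finite bound at a single e bounds each of them. *)
Lemma steiner_coef_fin (e M : R) (k : 'I_n.+1) : 0 < e ->
  (P e <= M%:E)%E -> L k = (fine (L k))%:E.
Proof.
move=> e0 PM; have c0 : 0 < e ^+ (n.+1 - k) * a k by rewrite mulr_gt0// exprn_gt0.
have := le_trans (steiner_term_le k e0) PM.
by case: (L k) (L0 k) => // _; rewrite mulry gtr0_sg// mul1e leye_eq.
Qed.

(* The top coefficient is the linear term of the Steiner polynomial. *)
Lemma steiner_top_eq0 C : (forall e, 0 < e <= 1 -> (P e <= (C * e ^+ 2)%:E)%E) ->
  L ord_max = 0%E.
Proof.
move=> H; have PM : (P 1 <= (C * 1 ^+ 2)%:E)%E by apply: H; rewrite ltr01 lexx.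
have l0 := L0 ord_max; rewrite (steiner_coef_fin ord_max ltr01 PM) lee_fin in l0 *.
have am0 := a0 ord_max.
have {}H e : 0 < e <= 1 -> a ord_max * fine (L ord_max) <= C * e.
  move=> /[dup] e01 /H; have /andP[e0 e1] := e01.
  move=> /(le_trans (steiner_term_le ord_max e0)).
  rewrite subSnn expr1 (steiner_coef_fin ord_max ltr01 PM) -EFinM lee_fin/=.
  move=> Hl; rewrite -(ler_pM2l e0) mulrA; apply: le_trans Hl _.
  by rewrite expr2 mulrCA.
congr (_%:E); apply/eqP; rewrite eq_le l0 andbT leNgt; apply/negP => lpos.
set l := fine _ in l0 H lpos; set b := a _ in am0 H.
have bl : 0 < b * l by rewrite mulr_gt0.
have C0 : 0 < C by have := H 1; rewrite ltr01 lexx => /(_ isT); lra.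
(* Makes C e at most half of b l, against [H]. *)
pose e := Num.min 1 (b * l / (2 * C)).
have e0 : 0 < e by rewrite lt_min ltr01 divr_gt0// mulr_gt0.
have e1 : e <= 1 by rewrite ge_min lexx.
have e2 : e * (2 * C) <= b * l by rewrite -ler_pdivlMr ?mulr_gt0// ge_min lexx orbT.
by have := H e; rewrite e0 e1 => /(_ isT); nra.
Qed.

(** After division by e, every term but the top one still carries a factor e and disappears as e
    tends to 0; what remains of the polynomial is the top coefficient. *)
Lemma steiner_top_ge (e0 c M : R) : 0 < e0 <= 1 -> (P e0 <= M%:E)%E ->
  (forall e, 0 < e <= e0 -> ((c * e)%:E <= P e)%E) ->
  ((c / a ord_max)%:E <= L ord_max)%E.
Proof.
move=> /andP[e00 e01] PM H.
pose l k := fine (L k); have Ll k : L k = (l k)%:E by exact: steiner_coef_fin e00 PM.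
have l0 k : 0 <= l k by rewrite -lee_fin -Ll.
rewrite Ll lee_fin ler_pdivrMr//.
pose S := \sum_(k < n) a (widen_ord (leqnSn n) k) * l (widen_ord (leqnSn n) k).
have S0 : 0 <= S by apply: sumr_ge0 => k _; rewrite mulr_ge0// ltW.
have {}H e : 0 < e <= e0 -> c <= e * S + l ord_max * a ord_max.
  move=> /[dup] eb /H; have /andP[ep ee0] := eb.
  have PE : P e = (\sum_(k < n.+1) e ^+ (n.+1 - k) * a k * l k)%:E.
    by rewrite /P -sumEFin; apply: eq_bigr => k _; rewrite Ll EFinM.
  rewrite PE lee_fin big_ord_recr/= subSnn expr1 => Hc.
  rewrite -(ler_pM2r ep); apply: le_trans Hc _.
  rewrite mulrDl; apply: lerD; last by rewrite -mulrA mulrC (mulrC (l _)).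
  rewrite mulrAC -expr2 mulr_sumr; apply: ler_sum => k _.
  rewrite -mulrA ler_wpM2r//; first by rewrite mulr_ge0// ltW.
  (* Below the top index the exponent of e is at least 2, and e <= 1 allows all these powers to be
     bounded by e^2. *)
  have nk : (n.+1 - k = 2 + (n - k - 1))%N.
    by rewrite subSn ?(ltnW (ltn_ord k))// subn1 add2n prednK// subn_gt0.
  rewrite nk exprD ler_piMr ?sqr_ge0// exprn_ile1//; first exact: ltW.
  exact: le_trans ee0 e01.
rewrite leNgt; apply/negP => cb; set b := l _ * a _ in H cb.
pose e := Num.min e0 ((c - b) / (S + 1)).
have e0' : 0 < e by rewrite lt_min e00 divr_gt0 ?subr_gt0// ltr_wpDl.
have e1 : e <= e0 by rewrite ge_min lexx.
have e2 : e * (S + 1) <= c - b by rewrite -ler_pdivlMr ?ltr_wpDl// ge_min lexx orbT.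
by have := H e; rewrite e0' e1 => /(_ isT); nra.
Qed.

End steiner_polynomial.

(** * Surface tensors of a prism *)

Section flip.
Variables (R : realType) (n : nat).
Implicit Types K : convex_body R n.

Lemma flip_compact K : compact [set - y | y in (K : set 'rV[R]_n)].
Proof.
apply: continuous_compact; last exact: body_compact.
apply: continuous_subspaceT => y.
by have := @cvgN R 'rV[R]_n _ (nbhs y) _ id y; apply; exact: cvg_id.
Qed.

Lemma flip_convex K :
  convex_set ([set - y | y in (K : set _)] : set (convex_lmodType 'rV[R]_n)).
Proof.
move=> a b l; rewrite !inE => -[a' Ka' <-] [b' Kb' <-].
have := @body_convex _ _ K a' b' l (mem_set Ka') (mem_set Kb').
rewrite inE => Kab; exists ((a' : convex_lmodType 'rV[R]_n) <| l |> b') => //.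
by rewrite /conv/= opprD !scalerN.
Qed.

Definition flip K : convex_body R n :=
  ConvexBody (@flip_compact K) (@flip_convex K).

End flip.

Notation ord1st := (lift ord0 ord0).

Section prism.
Variables (R : realType) (n : nat).

Definition prism_set (h : R) : set 'rV[R]_n.+2 :=
  [set z | (forall j, 0 <= z 0 j <= h) /\ z 0 ord0 + z 0 ord1st <= h].

Lemma prism_compact h : compact (prism_set h).
Proof.
pose A : set 'rV[R]_n.+2 := [set z | forall j, `[0, h]%classic (z ord0 j)].
have -> : prism_set h = A `&` [set z : 'rV[R]_n.+2 | dot z ('e_ord0 + 'e_ord1st) <= h].
  apply/seteqP; split => z /=; rewrite dotDr !dot_delta => -[zA zh]; split => // j.
apply: compact_closedI.
  by apply: (@rV_compact _ _ (fun=> `[0, h]%classic)) => _; exact: segment_compact.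
have cd := @continuous_dotl R n.+2 ('e_ord0 + 'e_ord1st).
rewrite (_ : mkset _ = (fun z => dot z ('e_ord0 + 'e_ord1st)) @^-1` [set t | t <= h])//.
by apply: preimage_closed; [move=> z _; exact: cd|exact: closed_le].
Qed.

Lemma prism_convex h : convex_set (prism_set h : set (convex_lmodType 'rV[R]_n.+2)).
Proof.
move=> a b l; rewrite !inE => -[a1 a2] [b1 b2].
rewrite /conv/=; have l0 : 0 <= l%:num by []; have l1 : l%:num <= 1 by [].
move: (l%:num) l0 l1 => t t0 t1.
have E (j : 'I_n.+2) : ((t *: a + (1 - t) *: b : 'rV[R]_n.+2) 0 j) =
    t * a 0 j + (1 - t) * b 0 j.
  by rewrite !mxE.
split=> [j|]; rewrite !E; last by nra.
by have /andP[? ?] := a1 j; have /andP[? ?] := b1 j; apply/andP; split; nra.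
Qed.

Definition prism h : convex_body R n.+2 :=
  ConvexBody (@prism_compact h) (@prism_convex h).

End prism.

Section prism_copies.
Variables (R : realType) (n : nat) (h sg : R) (x : 'rV[R]_n.+2).
Variable B : convex_body R n.+2.
Hypothesis h0 : 0 < h.
Hypothesis sg1 : sg * sg = 1.
(** One description for both bodies to be compared: sg = 1 is a translate of the prism, sg = -1 a
    translate of its reflection. *)
Hypothesis hB : forall X, body_set B X <-> @prism_set R n h (sg *: (X - x)).

Lemma prism_copy_nonempty : body_set B !=set0.
Proof.
exists x; apply/hB; rewrite subrr scaler0; split => [j|]; rewrite !mxE ?addr0 ?lexx ?ltW//.
Qed.

Lemma prism_copy_proj X : @prism_set R n h (sg *: (metric_proj B X - x)).
Proof. by apply/hB; exact: (metric_projP X prism_copy_nonempty).1. Qed.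

Lemma prism_copy_var X z : @prism_set R n h z ->
  sg * dot (X - metric_proj B X) (z - sg *: (metric_proj B X - x)) <= 0.
Proof.
move=> Hz; have : body_set B (x + sg *: z).
  by apply/hB; rewrite addrC addKr scalerA sg1 scale1r.
move=> /(metric_proj_dot X); rewrite -dotZr scalerBr scalerA sg1 scale1r.
by rewrite opprB addrA [_ + x]addrC.
Qed.

(** If the prism leaves room to move from the (pulled back) foot point by c along an axis, then the
    outward vector cannot point that way. Applied to suitable c, this locates the foot point from
    the signs of the normal. *)
Lemma prism_copy_dir X (i : 'I_n.+2) c :
  let q := sg *: (metric_proj B X - x) in
  @prism_set R n h (q + c *: 'e_i) ->
  sg * (X - metric_proj B X) 0 i * c <= 0.
Proof.
move=> q /(prism_copy_var X); rewrite -/q (addrC q) addrK dotZr dot_delta.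
by rewrite mulrCA mulrC.
Qed.

(** Coordinates 0 and 1 of the foot point can both be lowered to 0 inside the prism; with negative
    normal components this is only consistent if they are 0 already. So the foot lies over the
    right-angled vertex of the triangle. *)
Lemma prism_copy_vertex0 X : sg * (X - metric_proj B X) 0 ord0 < 0 ->
  sg * (X - metric_proj B X) 0 ord1st < 0 ->
  metric_proj B X 0 ord0 = x 0 ord0 /\ metric_proj B X 0 ord1st = x 0 ord1st.
Proof.
have [qb qs] := prism_copy_proj X.
have := @prism_copy_dir X ord0; have := @prism_copy_dir X ord1st => /=.
set q := sg *: _ in qb qs *; move: (sg * _) (sg * _) => w0 w1 H1 H0 w00 w10.
have E j : metric_proj B X 0 j = x 0 j + sg * q 0 j.
  by rewrite /q !mxE mulrA sg1 mul1r; ring.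
clearbody q.
have /andP[q00 q0h] := qb ord0; have /andP[q10 q1h] := qb ord1st.
have {}H0 : w0 * - q 0 ord0 <= 0.
  apply: H0; split=> [j|]; rewrite !mxE/=; last by lra.
  have /andP[? ?] := qb j.
  case: eqP => [->|_]; rewrite /= ?mulr1 ?mulr0 ?addr0; last exact/andP.
  by rewrite subrr lexx ltW.
have {}H1 : w1 * - q 0 ord1st <= 0.
  apply: H1; split=> [j|]; rewrite !mxE/=; last by lra.
  have /andP[? ?] := qb j.
  case: eqP => [->|_]; rewrite /= ?mulr1 ?mulr0 ?addr0; last exact/andP.
  by rewrite subrr lexx ltW.
have q0 : q 0 ord0 = 0 by nra.
have q1 : q 0 ord1st = 0 by nra.
by rewrite !E q0 q1 mulr0 !addr0.
Qed.

(** The foot lies over the acute vertex on the axis of coordinate 0. *)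
Lemma prism_copy_vertex1 X : 0 < sg * (X - metric_proj B X) 0 ord0 ->
  sg * (X - metric_proj B X) 0 ord1st < 0 ->
  metric_proj B X 0 ord0 = x 0 ord0 + sg * h /\
  metric_proj B X 0 ord1st = x 0 ord1st.
Proof.
have [qb qs] := prism_copy_proj X.
have := @prism_copy_dir X ord0; have := @prism_copy_dir X ord1st => /=.
set q := sg *: _ in qb qs *; move: (sg * _) (sg * _) => w0 w1 H1 H0 w00 w10.
have E j : metric_proj B X 0 j = x 0 j + sg * q 0 j.
  by rewrite /q !mxE mulrA sg1 mul1r; ring.
clearbody q.
have /andP[q00 q0h] := qb ord0; have /andP[q10 q1h] := qb ord1st.
have {}H1 : w1 * - q 0 ord1st <= 0.
  apply: H1; split=> [j|]; rewrite !mxE/=; last by lra.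
  have /andP[? ?] := qb j.
  case: eqP => [->|_]; rewrite /= ?mulr1 ?mulr0 ?addr0; last exact/andP.
  by rewrite subrr lexx ltW.
have q1 : q 0 ord1st = 0 by nra.
(* Only now that q_1 = 0 may coordinate 0 be raised to h without crossing the hypotenuse. *)
have {}H0 : w0 * (h - q 0 ord0) <= 0.
  apply: H0; split=> [j|]; rewrite !mxE/=; last by lra.
  have /andP[? ?] := qb j.
  case: eqP => [->|_]; rewrite /= ?mulr1 ?mulr0 ?addr0; last exact/andP.
  by rewrite addrC subrK lexx ltW.
have q0 : q 0 ord0 = h by nra.
by rewrite !E q0 q1 mulr0 !addr0.
Qed.

End prism_copies.

Section prism_copies_measure.
Variables (R : realType) (n : nat) (h sg : R) (x : 'rV[R]_n.+2).
Variable B : convex_body R n.+2.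
Hypothesis h0 : 0 < h.
Hypothesis sg1 : sg * sg = 1.
Hypothesis hB : forall X, body_set B X <-> @prism_set R n h (sg *: (X - x)).

Lemma prism_copy_proj_box X j :
  x 0 j - h <= metric_proj B X 0 j <= x 0 j + h.
Proof.
have [/(_ j) qj _] := prism_copy_proj h0 hB X.
rewrite !mxE in qj; move: qj.
have /eqP := sg1; rewrite -expr2 sqrf_eq1 => /orP[]/eqP-> => /andP[? ?];
  by apply/andP; split; lra.
Qed.

Lemma local_parallel_coord e A X j : 0 < e -> local_parallel_set B e A X ->
  `|X 0 j - metric_proj B X 0 j| <= e.
Proof.
move=> e0 /(local_parallel_setP e0)[_ [_ [Xe _]]].
by apply: le_trans Xe; have := coord_le_enorm (X - metric_proj B X) j; rewrite !mxE.
Qed.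

Lemma local_parallel_le_box e A : 0 < e <= 1 ->
  (lebesgueN (local_parallel_set B e A) <= (\prod_(j < n.+2) (2 * h + 2))%:E)%E.
Proof.
move=> /andP[e0 e1].
pose l (j : 'I_n.+2) := x 0 j - h - 1; pose r (j : 'I_n.+2) := x 0 j + h + 1.
apply: (@le_trans _ _ (\prod_(j < n.+2) (r j - l j))%:E); last first.
  by rewrite lee_fin (eq_bigr (fun=> 2 * h + 2))// => j _; rewrite /l /r; ring.
apply: lebesgueN_le_box => [j|X XP j]; first by rewrite /l /r; move: (h0); lra.
have := local_parallel_coord j e0 XP; rewrite ler_norml => /andP[? ?].
have /andP[? ?] := prism_copy_proj_box X j.
by apply/andP; rewrite /l /r; split; lra.
Qed.

(** Points projecting to a fixed face of codimension two lie within e of it in both coordinates 0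
    and 1; these two sides of length 2 e give the factor 4 e^2, and each remaining side has length 2
    (h + 1). *)
Lemma local_parallel_le_vertex e A c0 c1 : 0 < e <= 1 ->
  (forall X, local_parallel_set B e A X ->
    metric_proj B X 0 ord0 = c0 /\ metric_proj B X 0 ord1st = c1) ->
  (lebesgueN (local_parallel_set B e A) <=
    (4 * (\prod_(j < n) (2 * h + 2)) * e ^+ 2)%:E)%E.
Proof.
move=> /andP[e0 e1] H; have hp := h0.
pose c (j : 'I_n.+2) := if j == ord0 then c0 else if j == ord1st then c1 else x 0 j.
pose w (j : 'I_n.+2) := if (j == ord0) || (j == ord1st) then e else h + 1.
have w0 j : 0 < w j by rewrite /w; case: ifP => // _; by move: (h0); lra.
apply: (@le_trans _ _ (\prod_(j < n.+2) ((c j + w j) - (c j - w j)))%:E).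
  apply: lebesgueN_le_box => [j|X XP j]; first by have := w0 j; lra.
  have := local_parallel_coord j e0 XP; rewrite ler_norml => /andP[? ?].
  have [p0 p1] := H X XP; rewrite /c /w.
  case: eqP => [j0|_] /=; first by apply/andP; subst j; split; lra.
  case: eqP => [j0|_] /=; first by apply/andP; subst j; split; lra.
  by have /andP[? ?] := prism_copy_proj_box X j; apply/andP; split; lra.
rewrite lee_fin big_ord_recl big_ord_recl.
rewrite [X in _ * (_ * X) <= _](eq_bigr (fun=> 2 * h + 2)); last first.
  by move=> j _; rewrite /w /=; ring.
rewrite /w /=; have P0 : 0 <= \prod_(j < n) (2 * h + 2) by apply: prodr_ge0 => j _; lra.
by rewrite le_eqVlt; apply/orP; left; apply/eqP; ring.
Qed.

Variable Lam : convex_body R n.+2 -> 'I_n.+2 ->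
  {measure set (borel ('rV[R]_n.+2 * 'rV[R]_n.+2)%type) -> \bar R}.
Hypothesis hLam : is_support_measures Lam.

Implicit Types A : set (borel ('rV[R]_n.+2 * 'rV[R]_n.+2)%type).

Lemma prism_copy_steiner e A : measurable A -> A `<=` setT `*` @sphere R n.+2 ->
  0 < e -> lebesgueN (local_parallel_set B e A) =
    (\sum_(k < n.+2) (e ^+ (n.+2 - k) * kappa R (n.+2 - k))%:E * Lam B k A)%E.
Proof.
by move=> mA AS e0; apply: (hLam B mA AS).1 => //; exact: prism_copy_nonempty h0 hB.
Qed.

(** A parallel volume of order e^2 has no linear term, so the top support measure does not charge
    normals at a face of codimension two. *)
Lemma prism_copy_top_eq0 A c0 c1 : measurable A -> A `<=` setT `*` @sphere R n.+2 ->
  (forall e X, 0 < e -> local_parallel_set B e A X ->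
    metric_proj B X 0 ord0 = c0 /\ metric_proj B X 0 ord1st = c1) ->
  Lam B ord_max A = 0%E.
Proof.
move=> mA AS H.
have k0 (k : 'I_n.+2) : 0 < kappa R (n.+2 - k) by exact: kappa_gt0.
have L0 (k : 'I_n.+2) : (0 <= Lam B k A)%E by [].
apply: (steiner_top_eq0 k0 L0 (C := 4 * (\prod_(j < n) (2 * h + 2)))) => e e01.
have /andP[e0 e1] := e01; rewrite -prism_copy_steiner//.
by apply: local_parallel_le_vertex e01 _ => X; exact: H.
Qed.

(** Finiteness is not assumed of the support measures; it comes from the Steiner formula at e = 1,
    where the parallel set is bounded. *)
Lemma prism_copy_top_fin A : measurable A -> A `<=` setT `*` @sphere R n.+2 ->
  Lam B ord_max A = (fine (Lam B ord_max A))%:E.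
Proof.
move=> mA AS.
have k0 (k : 'I_n.+2) : 0 < kappa R (n.+2 - k) by exact: kappa_gt0.
have L0 (k : 'I_n.+2) : (0 <= Lam B k A)%E by [].
apply: (steiner_coef_fin k0 L0 (M := \prod_(j < n.+2) (2 * h + 2)) ord_max ltr01).
by rewrite -prism_copy_steiner//; apply: local_parallel_le_box; rewrite ltr01 lexx.
Qed.

End prism_copies_measure.

(** Off the null set where f < 0, f dominates v times the indicator of A. With A a facet this bounds
    a tensor coordinate below; with A empty it only yields a sign. *)
Lemma finite_measure_ge (R : realType) d (T : measurableType d)
    (nu : {measure set T -> \bar R}) (D A : set T) (f : T -> R) (v : R) :
  measurable D -> (nu D < +oo)%E -> measurable A -> A `<=` D ->
  measurable_fun D f -> (forall t, D t -> `|f t| <= 1) ->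
  0 <= v -> (forall t, A t -> v <= f t) ->
  nu (D `&` [set t | f t < 0]) = 0%E ->
  v * fine (nu A) <= \int[nu]_(t in D) f t.
Proof.
move=> mD Doo mA AD mf f1 v0 Av N0.
have fi : nu.-integrable D (EFin \o f).
  apply: measurable_bounded_integrable => //.
  by exists 1; split=> // M M1 t Dt; apply: le_trans (f1 t Dt) (ltW M1).
pose g t := v * \1_A t.
have mg : measurable_fun D g.
  by apply: measurable_funM => //; exact: measurable_indic.
have gi : nu.-integrable D (EFin \o g).
  apply: measurable_bounded_integrable => //.
  exists v; split=> [|M M1 t Dt]; first exact: num_real.
  rewrite /= /g indicE; case: (_ \in _); rewrite ?mulr1 ?mulr0 ger0_norm//; first exact: ltW.
  exact: le_trans v0 (ltW M1).
have -> : v * fine (nu A) = \int[nu]_(t in D) g t.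
  rewrite /Rintegral /g integralZl_indic//= ?integral_indic//.
    rewrite (setIidl AD) fineM// ge0_fin_numE//.
    by apply: le_lt_trans Doo; apply: le_measure => //; rewrite inE.
  by move=> /lt_geF; rewrite v0.
set N := D `&` _ in N0.
have mN : measurable N.
  have -> : N = D `&` f @^-1` `]-oo, 0[.
    by apply/seteqP; split => t [Dt]; rewrite /= in_itv/=.
  exact: mf.
rewrite /Rintegral (negligible_integral mN mD fi N0) (negligible_integral mN mD gi N0).
apply: (@le_Rintegral _ _ _ nu (D `\` N) g f) => [|||t [Dt nNt]].
- exact: measurableD.
- by apply: (integrableS mD _ _ gi); [exact: measurableD|exact: subDsetl].
- by apply: (integrableS mD _ _ fi); [exact: measurableD|exact: subDsetl].
rewrite /g indicE; case: (boolP (t \in A)) => [/set_mem /Av|_].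
  by rewrite mulr1.
by rewrite mulr0 leNgt; apply/negP => ft; exact: nNt.
Qed.

Section prism_face.
Variables (R : realType) (n : nat) (h : R) (x : 'rV[R]_n.+2).
Variable B : convex_body R n.+2.
Hypothesis h0 : 0 < h.
Hypothesis hB : forall X, body_set B X <-> @prism_set R n h (X - x).

Let hB1 X : body_set B X <-> @prism_set R n h (1 *: (X - x)).
Proof. by rewrite scale1r. Qed.

Definition diag01 : 'rV[R]_n.+2 := 'e_ord0 + 'e_ord1st.

Lemma diag01E j : diag01 0 j = ((j == ord0) || (j == ord1st))%:R.
Proof.
rewrite !mxE !eqxx/=; case: eqP => [->|_] /=; first by rewrite addr0.
by rewrite add0r.
Qed.

Lemma dot_diag01 : dot diag01 diag01 = 2.
Proof. by rewrite dotDr !dot_delta !diag01E. Qed.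

Lemma enorm_diag01 : enorm diag01 = Num.sqrt 2.
Proof. by rewrite /enorm dot_diag01. Qed.

(** The outer unit normal of the hypotenuse facet. *)
Definition face_normal : 'rV[R]_n.+2 := (Num.sqrt 2)^-1 *: diag01.

Lemma enormZ (m : nat) (a : R) (v : 'rV[R]_m) : 0 <= a -> enorm (a *: v) = a * enorm v.
Proof.
move=> a0; rewrite /enorm dotZl dotZr mulrA -expr2 sqrtrM ?sqr_ge0//.
by rewrite sqrtr_sqr ger0_norm.
Qed.

(** A slab over the middle of the hypotenuse. Its lower height e / 2 keeps it off the prism; the
    range of z_0 keeps its foot points away from the ends of the facet. *)
Lemma face_parallel e X (z := X - x) : 0 < e -> e <= h / 2 ->
  h / 4 <= z 0 ord0 <= h / 2 ->
  h + e / 2 <= z 0 ord0 + z 0 ord1st <= h + e ->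
  (forall j, j != ord0 -> j != ord1st -> 0 <= z 0 j <= h) ->
  local_parallel_set B e (setT `*` [set face_normal]) X.
Proof.
move=> e0 eh /andP[z0 z0h] /andP[z1 z1h] zj; have hp := h0.
(* Half the excess over h: lowering coordinates 0 and 1 by t lands on the hypotenuse. As t <= e / 2
   <= h / 4 <= z_0, the foot is in the prism, at distance t times the root of 2, hence at most e. *)
pose t := (z 0 ord0 + z 0 ord1st - h) / 2.
have t0 : 0 < t by rewrite /t; lra.
have te : t <= e / 2 by rewrite /t; lra.
pose p := X - t *: diag01.
have Xp : X - p = t *: diag01 by rewrite /p opprB addrC subrK.
have pE j : (p - x) 0 j = z 0 j - t * diag01 0 j by rewrite !mxE; ring.
have Bp : body_set B p.
  apply/hB; split=> [j|]; rewrite !pE !diag01E; last by rewrite /= /t; lra.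
  have [->|j0] /= := eqVneq j ord0; first by apply/andP; split; lra.
  have [->|j1] /= := eqVneq j ord1st; first by apply/andP; rewrite /t; split; lra.
  by rewrite mulr0 subr0; exact: zj.
have pX : metric_proj B X = p.
  apply: metric_proj_eq => // y /hB[yb ys].
  rewrite Xp dotZl dotC dotDr !dot_delta.
  have E j : (y - p) 0 j = (y - x) 0 j - (p - x) 0 j by rewrite !mxE; ring.
  rewrite !E !pE !diag01E/=; move: ys; set a := _ 0 _; set b := _ 0 _ => ys.
  rewrite mulr_ge0_le0//; first exact: ltW.
  by rewrite /t; lra.
have s20 : 0 < Num.sqrt 2 :> R by rewrite sqrtr_gt0.
split; last first.
  split=> //=; rewrite /normal_dir pX Xp enormZ ?(ltW t0)// enorm_diag01.
  rewrite scalerA /face_normal; congr (_ *: _).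
  by rewrite invfM mulrAC mulVf ?gt_eqF// mul1r.
split=> [|/hB[_]]; last by rewrite /z in z1 *; move: z1 => /=; lra.
exists p => //; exists (t *: diag01); last by rewrite -Xp addrC subrK.
suff : enorm (t *: diag01) <= e by [].
rewrite enormZ ?(ltW t0)// enorm_diag01.
have s22 : Num.sqrt 2 <= 2 :> R.
  by rewrite -ler_sqr ?nnegrE ?sqrtr_ge0// sqr_sqrtr// expr2; lra.
by apply: le_trans (ler_wpM2l (ltW t0) s22) _; lra.
Qed.

(** Coordinate 0 ranges over a length h / 4, coordinate 1 over e / 2 and the others over h. The
    range of coordinate 1 depends on coordinate 0, so the slab is measured slice by slice and not as
    a box. *)
Lemma lebesgueN_face e : 0 < e -> e <= h / 2 ->
  ((h ^+ n.+1 / 8 * e)%:E <=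
    lebesgueN (local_parallel_set B e (setT `*` [set face_normal])))%E.
Proof.
move=> e0 eh; have hp := h0.
rewrite (_ : _ * e = (x 0 ord0 + h / 2 - (x 0 ord0 + h / 4)) * (e / 2 * h ^+ n)); last first.
  by rewrite exprS; field.
apply: lebesgueN_ge_slices => [||u u01]; first by lra.
  by rewrite mulr_ge0 ?exprn_ge0 ?(ltW hp)//; lra.
pose l (j : 'I_n.+1) := if j == ord0 then x 0 ord1st + h - (u - x 0 ord0) + e / 2
  else x 0 (lift ord0 j).
pose r (j : 'I_n.+1) := if j == ord0 then x 0 ord1st + h - (u - x 0 ord0) + e
  else x 0 (lift ord0 j) + h.
have lr j : l j <= r j by rewrite /l /r; case: ifP => _; lra.
have -> : e / 2 * h ^+ n = \prod_j (r j - l j).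
  rewrite big_ord_recl /r /l /= (eq_bigr (fun=> h)).
    by rewrite prodr_const card_ord; congr (_ * _); lra.
  by move=> j _; rewrite /=; ring.
rewrite -lebesgueN_box//; apply: le_lebesgueN => y yb.
rewrite /slice /=; set X := row_mx _ _.
have X0 : X 0 ord0 = u by exact: row_mx_ord0.
have X1 j : X 0 (lift ord0 j) = y 0 j by exact: row_mx_lift0.
have /andP[u0 u1] := u01.
have /andP[] := yb ord0; rewrite /l /r /= => y0 y1.
have E j : (X - x) 0 j = X 0 j - x 0 j by rewrite !mxE.
apply: face_parallel => //; rewrite ?E ?X0 ?X1.
- by apply/andP; split; lra.
- by apply/andP; split; lra.
move=> j; case: (unliftP ord0 j) => [k ->|-> //] _ k1; rewrite E X1.
have k0 : (k == ord0) = false by apply: contraNF k1 => /eqP ->.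
by have := yb k; rewrite /l /r k0 => /andP[? ?]; apply/andP; split; lra.
Qed.

Variable Lam : convex_body R n.+2 -> 'I_n.+2 ->
  {measure set (borel ('rV[R]_n.+2 * 'rV[R]_n.+2)%type) -> \bar R}.
Hypothesis hLam : is_support_measures Lam.

Definition face_set : set (borel ('rV[R]_n.+2 * 'rV[R]_n.+2)%type) :=
  setT `*` [set face_normal].

Lemma face_set_sphere : face_set `<=` setT `*` @sphere R n.+2.
Proof.
move=> [X u] [_ /= ->]; split => //; rewrite /sphere/= enormZ ?invr_ge0//.
by rewrite enorm_diag01 mulVf// gt_eqF// sqrtr_gt0.
Qed.

Lemma measurable_face_set : measurable face_set.
Proof.
apply: borel_closed.
rewrite (_ : face_set = snd @^-1` [set face_normal]).
  apply: preimage_closed => [? _|]; first exact: cvg_snd.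
  exact/accessible_closed_set1/hausdorff_accessible/norm_hausdorff.
by apply/seteqP; split => [[X u] [_ //]|[X u] //].
Qed.

(** The linear coefficient of the Steiner polynomial is [kappa R 1] times the top measure, which
    explains the last division. *)
Lemma top_face_ge : ((h ^+ n.+1 / 8 / kappa R 1)%:E <= Lam B ord_max face_set)%E.
Proof.
have k0 (k : 'I_n.+2) : 0 < kappa R (n.+2 - k) by exact: kappa_gt0.
have L0 (k : 'I_n.+2) : (0 <= Lam B k face_set)%E by [].
have mF := measurable_face_set; have sF := face_set_sphere.
have h1 : (1 : R) * 1 = 1 by rewrite mulr1.
pose e1 := Num.min 1 (h / 2); have hp := h0.
have e10 : 0 < e1 by rewrite lt_min; apply/andP; split; lra.
have e11 : e1 <= 1 by rewrite ge_min lexx.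
have e1h : e1 <= h / 2 by rewrite ge_min lexx orbT.
have := steiner_top_ge k0 L0 (e0 := e1) (c := h ^+ n.+1 / 8)
  (M := \prod_(j < n.+2) (2 * h + 2)).
rewrite subSnn; apply=> [||e /andP[e0 ee1]]; first by rewrite e10.
  rewrite -(prism_copy_steiner h0 hB1 hLam)//.
  by apply: (local_parallel_le_box h0 h1 hB1); rewrite e10.
rewrite -(prism_copy_steiner h0 hB1 hLam)//; apply: lebesgueN_face => //.
exact: le_trans ee1 e1h.
Qed.

End prism_face.

Section surface_tensor_of_prism.
Variables (R : realType) (n s : nat).
Hypotheses (s1 : (1 < s)%N) (sodd : odd s).

(* Among the facet normals of the prism, only the normal u of the slanted facet
   has u_1 u_0^(s-1) <> 0. *)
Definition mixed_index (m : nat) (j : 'I_m) : 'I_n.+2 :=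
  if val j == 0%N then ord1st else ord0.

Local Notation i0 := (@mixed_index s).

Lemma tensor_pow_mixed (u : 'rV[R]_n.+2) :
  tensor_coord (tensor_pow s u) i0 = u 0 ord1st * u 0 ord0 ^+ s.-1.
Proof.
rewrite /tensor_coord /=; case: s s1 => // m _.
rewrite big_ord_recl dot_delta; congr (_ * _).
rewrite (eq_bigr (fun=> u 0 ord0)); first by rewrite prodr_const card_ord.
by move=> j _; rewrite dot_delta.
Qed.

Lemma tensor_pow_mixed_le1 (u : 'rV[R]_n.+2) : enorm u = 1 ->
  `|tensor_coord (tensor_pow s u) i0| <= 1.
Proof.
move=> u1; rewrite tensor_pow_mixed normrM normrX.
have H j : `|u 0 j| <= 1 by rewrite -u1 coord_le_enorm.
by rewrite mulr_ile1 ?exprn_ge0 ?exprn_ile1.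
Qed.

Local Notation T := ('rV[R]_n.+2 * 'rV[R]_n.+2)%type.
Implicit Types A : set (borel T).

Let D : set (borel T) := [set: 'rV[R]_n.+2] `*` @sphere R n.+2.
Let f (q : borel T) : R := tensor_coord (tensor_pow s q.2) i0.

Let snd_continuous : continuous (snd : T -> 'rV[R]_n.+2).
Proof. by move=> q; exact: cvg_snd. Qed.

Lemma measurable_snd_coord j : measurable_fun [set: borel T] (fun q : borel T => q.2 0 j).
Proof.
apply: borel_continuous => q.
exact: (cvg_comp _ _ (@snd_continuous q) (@coord_continuous R 1 n.+2 0 j q.2)).
Qed.

Lemma measurable_mixed : measurable_fun [set: borel T] f.
Proof.
rewrite (_ : f = fun q => q.2 0 ord1st * q.2 0 ord0 ^+ s.-1); last first.
  by apply/funext => q; exact: tensor_pow_mixed.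
apply: measurable_funM; first exact: measurable_snd_coord.
by apply: measurable_funX; exact: measurable_snd_coord.
Qed.

Lemma measurable_sphere_bundle : measurable D.
Proof.
apply: borel_closed; rewrite (_ : D = (fun q : T => enorm q.2) @^-1` [set 1]).
  apply: preimage_closed => [q _|].
    exact: (cvg_comp _ _ (@snd_continuous q) (@continuous_enorm R n.+2 q.2)).
  exact/accessible_closed_set1/hausdorff_accessible/norm_hausdorff.
by apply/seteqP; split => [[X u] [_ //]|[X u] //].
Qed.

Variable Lam : convex_body R n.+2 -> 'I_n.+2 ->
  {measure set (borel ('rV[R]_n.+2 * 'rV[R]_n.+2)%type) -> \bar R}.
Hypothesis hLam : is_support_measures Lam.

(** No facet of the copy has a normal u with sg u_1 u_0^(s-1) < 0. As s - 1 is even and positive,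
    such a u has sg u_1 < 0 and u_0 <> 0; for either sign of sg u_0 the foot point lies over a
    vertex of the triangle. *)
Lemma prism_copy_mixed_null h sg (x : 'rV[R]_n.+2) (B : convex_body R n.+2) :
  0 < h -> sg * sg = 1 ->
  (forall X, body_set B X <-> @prism_set R n h (sg *: (X - x))) ->
  Lam B ord_max (D `&` [set q | sg * f q < 0]) = 0%E.
Proof.
move=> h0 sg1 hB.
have mD := measurable_sphere_bundle.
have mc j : measurable_fun [set: borel T] (fun q : borel T => sg * q.2 0 j).
  by apply: measurable_funM => //; exact: measurable_snd_coord.
have mneg j : measurable ([set q : borel T | sg * q.2 0 j < 0]).
  have := mc j measurableT `]-oo, 0[%classic (measurable_itv _); rewrite setTI.
  by congr (measurable _); apply/seteqP; split => q; rewrite /= in_itv/=.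
have mpos j : measurable ([set q : borel T | 0 < sg * q.2 0 j]).
  have := mc j measurableT `]0, +oo[%classic (measurable_itv _); rewrite setTI.
  by congr (measurable _); apply/seteqP; split => q; rewrite /= in_itv/= andbT.
pose A1 := D `&` ([set q : borel T | sg * q.2 0 ord1st < 0] `&`
  [set q : borel T | sg * q.2 0 ord0 < 0]).
pose A2 := D `&` ([set q : borel T | sg * q.2 0 ord1st < 0] `&`
  [set q : borel T | 0 < sg * q.2 0 ord0]).
have mA1 : measurable A1 by apply: measurableI => //; exact: measurableI.
have mA2 : measurable A2 by apply: measurableI => //; exact: measurableI.
(* The normal direction has the same signs as the unnormalized outward vector. *)
have shift_alongE e A X j : 0 < e -> local_parallel_set B e A X -> exists2 c, 0 < c &
    normal_dir B X 0 j = c * (X - metric_proj B X) 0 j.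
  move=> e0 /(local_parallel_setP e0)[_ [_ [_ w0]]].
  by exists (enorm (X - metric_proj B X))^-1; rewrite ?invr_gt0// /normal_dir mxE.
have N1 : Lam B ord_max A1 = 0%E.
  apply: (prism_copy_top_eq0 h0 sg1 hB hLam mA1 _
    (c0 := x 0 ord0) (c1 := x 0 ord1st)); first exact: subIsetl.
  move=> e X e0 XP; have [c c0 Ec] := shift_alongE _ _ _ ord0 e0 XP.
  have [d d0 Ed] := shift_alongE _ _ _ ord1st e0 XP.
  have [_ [_ /=]] := XP; rewrite Ec Ed !(mulrCA sg) (pmulr_rlt0 _ c0) (pmulr_rlt0 _ d0).
  move=> [w1 w0].
  exact: (prism_copy_vertex0 h0 sg1 hB).
have N2 : Lam B ord_max A2 = 0%E.
  apply: (prism_copy_top_eq0 h0 sg1 hB hLam mA2 _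
    (c0 := x 0 ord0 + sg * h) (c1 := x 0 ord1st)); first exact: subIsetl.
  move=> e X e0 XP; have [c c0 Ec] := shift_alongE _ _ _ ord0 e0 XP.
  have [d d0 Ed] := shift_alongE _ _ _ ord1st e0 XP.
  have [_ [_ /=]] := XP; rewrite Ec Ed !(mulrCA sg) (pmulr_rlt0 _ d0) (pmulr_rgt0 _ c0).
  move=> [w1 w0].
  exact: (prism_copy_vertex1 h0 sg1 hB).
have mf0 : measurable (D `&` [set q | sg * f q < 0]).
  apply: measurableI => //.
  have mf : measurable_fun [set: borel T] (fun q => sg * f q).
    by apply: measurable_funM => //; exact: measurable_mixed.
  have := mf measurableT `]-oo, 0[%classic (measurable_itv _); rewrite setTI.
  by congr (measurable _); apply/seteqP; split => q; rewrite /= in_itv/=.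
apply: (@subset_measure0 _ _ _ (Lam B ord_max) _ (A1 `|` A2)) => //.
- exact: measurableU.
- move=> q [Dq]; rewrite /= /f tensor_pow_mixed.
  set u1 := q.2 0 ord1st; set u0 := q.2 0 ord0 => H.
  (* Here oddness of s enters: the factor is a square, so u_1 alone decides the sign. *)
  have E : u0 ^+ s.-1 = (u0 ^+ (s.-1)./2) ^+ 2.
    rewrite -exprM muln2 -[in LHS](odd_double_half s.-1).
    by move: sodd s1; case: (s) => //= m /negbTE ->.
  have {}H : sg * u1 * (u0 ^+ s.-1) < 0 by rewrite -mulrA.
  have p0 : 0 <= u0 ^+ s.-1 by rewrite E sqr_ge0.
  have w1 : sg * u1 < 0.
    by rewrite ltNge; apply/negP => w1; move: H; rewrite ltNge mulr_ge0.
  (* Here s > 1 enters: if u_0 = 0, the positive power makes the coordinate vanish. *)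
  have w0 : sg * u0 != 0.
    apply: contraTneq H => w0; have -> : u0 = 0.
      by rewrite -[u0]mul1r -sg1 -mulrA w0 mulr0.
    by rewrite expr0n; case: (s) s1 => [|[|m]]//= _; rewrite mulr0 ltxx.
  have [w|w|/eqP] := ltgtP (sg * u0) 0; last by rewrite (negbTE w0).
    by left.
  by right.
- apply/eqP; rewrite eq_le measure_ge0 andbT.
  apply: (le_trans (measureU2 _ mA1 mA2)).
  by rewrite [X in (X + _)%E]N1 [X in (_ + X)%E]N2 adde0.
Qed.

Lemma translate_memE (K : convex_body R n.+2) x X :
  body_set (translate K x) X <-> body_set K (X - x).
Proof.
split=> [[y Ky <-]|KX]; first by rewrite addrK.
by exists (X - x); rewrite // subrK.
Qed.

Lemma flip_memE (K : convex_body R n.+2) X : body_set (flip K) X <-> body_set K (- X).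
Proof.
split=> [[y Ky <-]|KX]; first by rewrite opprK.
by exists (- X); rewrite // opprK.
Qed.

(** For the prism the coordinate is at least the contribution of the hypotenuse, for the reflected
    prism it is at most 0; neither bound depends on x. *)
Lemma surface_tensor_gap (h : R) : 0 < h -> exists2 c, 0 < c & forall x,
  c <= surface_tensor_coord Lam (translate (@prism R n h) x) i0
     - surface_tensor_coord Lam (translate (flip (@prism R n h)) x) i0.
Proof.
move=> h0.
have k0 m : 0 < kappa R m := kappa_gt0 R m.
pose a : R := omega R 1 / (s`!%:R * omega R (1 + s)).
have a0 : 0 < a by rewrite divr_gt0 ?mulr_gt0// ?ltr0n ?fact_gt0//.
pose v := (Num.sqrt 2)^-1 * (Num.sqrt 2)^-1 ^+ s.-1 : R.
have v0 : 0 < v by rewrite mulr_gt0 ?exprn_gt0// invr_gt0 sqrtr_gt0.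
(* The normalizing factor of the tensor, the value of u_1 u_0^(s-1) at the normal of the hypotenuse,
   and the lower bound for the mass of that facet. *)
exists (a * (v * (h ^+ n.+1 / 8 / kappa R 1))).
  by do 2 (apply: mulr_gt0 => //); do 2 (apply: divr_gt0 => //); exact: exprn_gt0.
move=> x; rewrite /surface_tensor_coord -/a.
have mD := measurable_sphere_bundle.
have mf := measurable_mixed.
have f1 q : D q -> `|f q| <= 1 by case=> _ /= q1; exact: tensor_pow_mixed_le1.
have h1 : (1 : R) * 1 = 1 by rewrite mulr1.
have hN : (-1 : R) * -1 = 1 by rewrite mulrNN mulr1.
set K1 := translate _ x; set K2 := translate _ x.
have hK1 X : body_set K1 X <-> @prism_set R n h (X - x) by exact: translate_memE.
have hK1' X : body_set K1 X <-> @prism_set R n h (1 *: (X - x)) by rewrite scale1r.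
have hK2 X : body_set K2 X <-> @prism_set R n h (-1 *: (X - x)).
  by rewrite scaleN1r; apply: (iff_trans (translate_memE _ _ _)); exact: flip_memE.
have DD : D `<=` setT `*` @sphere R n.+2 by [].
have F1 := prism_copy_top_fin h0 h1 hK1' hLam mD DD.
have F2 := prism_copy_top_fin h0 hN hK2 hLam mD DD.
have N1 := prism_copy_mixed_null h0 h1 hK1'.
have N2 := prism_copy_mixed_null h0 hN hK2.
have mF := @measurable_face_set R n.
have sF := @face_set_sphere R n.
have nE j : (@face_normal R n) 0 j =
    (Num.sqrt 2)^-1 * ((j == ord0) || (j == ord1st))%:R.
  by rewrite /face_normal mxE diag01E.
have I1 : v * fine (Lam K1 ord_max (@face_set R n)) <= \int[Lam K1 ord_max]_(q in D) f q.
  apply: finite_measure_ge => //.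
  - by rewrite F1 ltry.
  - exact: measurable_funTS.
  - exact: ltW.
  - by move=> [X u] [_ /= ->]; rewrite /f tensor_pow_mixed !nE /= !mulr1.
  - rewrite -[RHS]N1; congr (Lam K1 ord_max (_ `&` _)).
    by apply/seteqP; split => q /=; rewrite mul1r.
have I2 : 0 <= \int[Lam K2 ord_max]_(q in D) (-1 * f q).
  have := @finite_measure_ge R _ _ (Lam K2 ord_max) D set0 (fun q => -1 * f q) 0.
  rewrite mul0r; apply => //.
  - by rewrite F2 ltry.
  - by apply: measurable_funTS; apply: measurable_funM.
  - by move=> q Dq; rewrite mulN1r normrN f1.
have fi : (Lam K2 ord_max).-integrable D (EFin \o f).
  apply: measurable_bounded_integrable => //.
  - by rewrite F2 ltry.
  - exact: measurable_funTS.
  - by exists 1; split=> // M M1 q Dq; apply: le_trans (f1 q Dq) (ltW M1).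
rewrite RintegralZl// mulN1r oppr_ge0 in I2.
have T1 : h ^+ n.+1 / 8 / kappa R 1 <= fine (Lam K1 ord_max (@face_set R n)).
  have := top_face_ge h0 hK1 hLam.
  by rewrite (prism_copy_top_fin h0 h1 hK1' hLam mF sF) lee_fin.
rewrite -mulrBr ler_wpM2l ?(ltW a0)//.
apply: le_trans (ler_wpM2l (ltW v0) T1) _; apply: le_trans I1 _.
by rewrite lerBrDr gerDl.
Qed.

End surface_tensor_of_prism.

Lemma convex_body_ext (R : realType) n (K L : convex_body R n) :
  body_set K = body_set L -> K = L.
Proof.
case: K L => [K cK vK] [L cL vL] /= E; subst L.
by rewrite (Prop_irrelevance cK cL) (Prop_irrelevance vK vL).
Qed.

Lemma line_ext (R : realType) n (E F : line R n) : line_set E = line_set F -> E = F.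
Proof.
by case: E F => [E hE] [F hF] /= EF; subst F; rewrite (Prop_irrelevance hE hF).
Qed.

(** * Lines and motions *)

Section lines_borel.
Variables (R : realType) (n : nat).
Implicit Types (E : line R n) (p u v x : 'rV[R]_n.+1).

Definition the_line p u (u0 : u != 0) : line R n :=
  Line (ex_intro _ p (ex_intro _ u (conj u0 erefl))).

Lemma measurable_line_open (U : set (line_borel R n)) : line_open U -> measurable U.
Proof. by move=> oU; exact: sub_sigma_algebra. Qed.

Lemma affine_line_dir p u p' u' : u != 0 ->
  affine_line p u = affine_line p' u' -> exists2 c, c != 0 & u = c *: u'.
Proof.
move=> u0 pu.
have [s _ Hs] : affine_line p' u' p by rewrite -pu; exists 0; rewrite // scale0r addr0.
have [t _ Ht] : affine_line p' u' (p + u) by rewrite -pu; exists 1; rewrite // scale1r.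
have uE : u = (t - s) *: u'.
  by rewrite scalerBl -[LHS](addKr p) -Ht -Hs opprD addrACA addNr add0r addrC.
by exists (t - s) => //; apply: contraNneq u0 => ts; rewrite uE ts scale0r.
Qed.

(** An arbitrary choice of direction, with no measurability in itself: only properties invariant
    under nonzero scaling are read off from it. *)
Definition line_dir E : 'rV[R]_n.+1 := projT1 (cid (projT2 (cid (line_setP E)))).
Definition line_pt E : 'rV[R]_n.+1 := projT1 (cid (line_setP E)).

Lemma line_dirP E : line_dir E != 0 /\ line_set E = affine_line (line_pt E) (line_dir E).
Proof. by rewrite /line_dir /line_pt; case: cid => p /= ?; case: cid => u []. Qed.

(** Scale invariance makes the choice in [line_dir] irrelevant, so the set of parameters is the
    preimage of P under the second projection. Excluding 0 takes care of the condition that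
    directions be nonzero. *)
Lemma line_open_dir (P : 'rV[R]_n.+1 -> Prop) :
  (forall c u, c != 0 -> P u -> P (c *: u)) -> ~ P 0 -> open [set u | P u] ->
  line_open [set E | P (line_dir E)].
Proof.
move=> Pc P0 oP; rewrite /line_open.
rewrite (_ : mkset _ = snd @^-1` [set u | P u]); last first.
  apply/seteqP; split => -[p u] /=.
    move=> [u0 [E PE Epu]]; have [d0 dE] := line_dirP E.
    by have [c c0 ->] := affine_line_dir u0 (etrans (esym Epu) dE); exact: Pc.
  move=> Pu; have u0 : u != 0 by apply/eqP => u0; apply: P0; rewrite -u0.
  split=> //; exists (the_line p u0) => //.
  have [d0 dE] := line_dirP (the_line p u0).
  by have [c c0 ->] := affine_line_dir d0 (esym dE); exact: Pc.
by apply: open_comp => // q _; exact: cvg_snd.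
Qed.

(* The Cauchy-Schwarz defect of c - p and u; it vanishes exactly when c lies on
   the line through p with direction u. *)
Definition line_defect (c p u : 'rV[R]_n.+1) : R :=
  dot u u * dot (c - p) (c - p) - dot (c - p) u ^+ 2.

(** G is |u|^2 times the component of c - p orthogonal to u. Both the sign of the defect and its
    vanishing are read off from this square. *)
Lemma line_defectE c p u (G := dot u u *: (c - p) - dot (c - p) u *: u) :
  dot G G = dot u u * line_defect c p u.
Proof.
rewrite /G dot_subZ !dotZl !dotZr /line_defect; ring.
Qed.

Lemma affine_line_defect c p u : u != 0 -> affine_line p u c <-> line_defect c p u = 0.
Proof.
move=> u0; have uu : dot u u != 0.
  by apply: contra_neq u0 => uu; apply: dot_eq0; rewrite uu.
split=> [[t _ <-]|d0].
  by rewrite /line_defect addrAC subrr add0r !dotZl !dotZr; ring.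
have : dot u u *: (c - p) - dot (c - p) u *: u = 0.
  by apply: dot_eq0; rewrite line_defectE d0 mulr0.
move=> /eqP; rewrite subr_eq0 => /eqP G0.
exists ((dot u u)^-1 * dot (c - p) u) => //.
by rewrite -scalerA -G0 scalerA mulVf// scale1r addrC subrK.
Qed.

Lemma line_defect_ge0 c p u : u != 0 -> 0 <= line_defect c p u.
Proof.
move=> u0; have uu : 0 < dot u u.
  rewrite lt_neqAle dot_ge0 andbT eq_sym.
  by apply: contra_neq u0 => uu; apply: dot_eq0; rewrite uu.
by rewrite -(pmulr_rge0 _ uu) -line_defectE dot_ge0.
Qed.

Lemma line_defect_continuous :
  continuous (fun q : 'rV[R]_n.+1 * ('rV[R]_n.+1 * 'rV[R]_n.+1) =>
    line_defect q.1 q.2.1 q.2.2).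
Proof.
have c1 : continuous (fun q : 'rV[R]_n.+1 * ('rV[R]_n.+1 * 'rV[R]_n.+1) => q.1 - q.2.1).
  move=> q; have := @cvgB R 'rV[R]_n.+1 _ (nbhs q) _ fst (fst \o snd) q.1 q.2.1.
  apply; first exact: cvg_fst.
  by apply: cvg_comp; [exact: cvg_snd|exact: cvg_fst].
have c2 : continuous (fun q : 'rV[R]_n.+1 * ('rV[R]_n.+1 * 'rV[R]_n.+1) => q.2.2).
  by move=> q; apply: cvg_comp; exact: cvg_snd.
have c22 := continuous_dot c2 c2; have c11 := continuous_dot c1 c1.
have c12 := continuous_dot c1 c2.
move=> q; rewrite /line_defect; apply: cvgB.
  by apply: cvgM; [exact: c22|exact: c11].
by under eq_fun do rewrite expr2; rewrite expr2; apply: cvgM; exact: c12.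
Qed.

(** The lines missing a compact set form an open set: the defect is positive on all of C, and by
    compactness it stays so for all nearby parameters simultaneously. *)
Lemma measurable_hits (C : set 'rV[R]_n.+1) : compact C ->
  measurable [set E : line_borel R n | (line_set E `&` C) !=set0].
Proof.
move=> cC; rewrite -(setCK (mkset _)); apply: measurableC.
apply: measurable_line_open; rewrite /line_open.
rewrite (_ : mkset _ = [set q : 'rV[R]_n.+1 * 'rV[R]_n.+1 | q.2 != 0 /\
    C `<=` [set c | 0 < line_defect c q.1 q.2]]); last first.
  apply/seteqP; split => -[p u] /= [u0].
    move=> [E nE Epu]; split=> // c Cc /=; rewrite lt_neqAle line_defect_ge0// andbT.
    apply/eqP => /esym d0; apply: nE; exists c; split => //=.
    by rewrite Epu; exact/affine_line_defect.
  move=> H; split=> //; exists (the_line p u0) => // -[c [/= Ec Cc]].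
  by have := H c Cc; rewrite /= (affine_line_defect c p u0).1 ?ltxx.
rewrite openE => q [q0 H].
have near0 : \forall q' \near q, q'.2 != 0.
  have : open [set q' : 'rV[R]_n.+1 * 'rV[R]_n.+1 | q'.2 != 0].
    rewrite (_ : mkset _ = snd @^-1` (~` [set 0])); last first.
      by apply/seteqP; split => q' /= /eqP.
    apply: open_comp => [? _|]; first exact: cvg_snd.
    rewrite openC.
    exact/accessible_closed_set1/hausdorff_accessible/norm_hausdorff.
  by rewrite openE; apply.
have nearC : \forall q' \near q, C `<=` [set c | 0 < line_defect c q'.1 q'.2].
  move/compact_near_coveringP : cC => /(_ _ (nbhs q)
    (fun q' c => 0 < line_defect c q'.1 q'.2)); apply => c Cc.
  have := @line_defect_continuous (c, q) [set t | 0 < t]; apply.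
  by apply: open_nbhs_nbhs; split; [exact: open_gt|exact: H].
exact: filterI near0 nearC.
Qed.

End lines_borel.

Section motions.
Variables (R : realType) (n : nat).
Implicit Types (E : line R n) (K : convex_body R n.+1) (p u v x : 'rV[R]_n.+1).

Lemma homothety_orthogonal (a : R) : a * a = 1 -> (a%:M : 'M[R]_n.+1) *m a%:M^T = 1%:M.
Proof. by move=> a1; rewrite tr_scalar_mx -scalar_mxM a1. Qed.

(** For a = 1 and a = -1 these are the translations and the point reflections, the motions applied
    below. They lift to continuous maps of the parameters, and the topology on lines is the quotient
    one. *)
Lemma move_line_measurable (a : R) (QQ : (a%:M : 'M[R]_n.+1) *m a%:M^T = 1%:M) v :
  a * a = 1 -> measurable_fun [set: line_borel R n]
    (move_line v QQ : line_borel R n -> line_borel R n).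
Proof.
move=> a1; apply: (@measurability _ _ (line_borel R n) (line_borel R n) _ _ (@line_open R n)) => //.
move=> _ [U oU <-]; rewrite setTI; apply: measurable_line_open.
have a0 : a != 0 by apply: contra_eq_neq a1 => ->; rewrite mul0r eq_sym oner_neq0.
pose phi (q : 'rV[R]_n.+1 * 'rV[R]_n.+1) := (a *: q.1 + v, a *: q.2).
have moveE E p u : line_set E = affine_line p u ->
    line_set (move_line v QQ E) = affine_line (a *: p + v) (a *: u).
  move=> /= ->; apply/seteqP; split => [_ [_ [t _ <-] <-]|_ [t _ <-]].
    by exists t => //; rewrite mul_mx_scalar scalerDr !scalerA mulrC addrAC.
  exists (p + t *: u); first by exists t.
  by rewrite mul_mx_scalar scalerDr !scalerA mulrC addrAC.
rewrite /line_open (_ : mkset _ = phi @^-1` [set q | q.2 != 0 /\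
    exists2 E, U E & E = affine_line q.1 q.2 :> set _]); last first.
  apply/seteqP; split => -[p u] /= [u0 [E UE Epu]].
    split; first by rewrite scaler_eq0 negb_or a0.
    by exists (move_line v QQ E) => //; exact: moveE.
  have {}u0 : u != 0 by move: u0; rewrite scaler_eq0 negb_or => /andP[].
  split=> //; exists (the_line p u0) => //.
  suff -> : move_line v QQ (the_line p u0) = E by [].
  by apply: line_ext; rewrite Epu; exact: moveE.
apply: open_comp => // q _.
have A1 : (a *: x.1 + v) @[x --> q] --> a *: q.1 + v.
  have := @cvgD R 'rV[R]_n.+1 _ (nbhs q) _ (fun q => a *: q.1) (cst v) (a *: q.1) v.
  apply; last exact: cvg_cst.
  by apply: cvgZl_tmp; exact: cvg_fst.
have A2 : (a *: x.2) @[x --> q] --> a *: q.2.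
  by apply: cvgZl_tmp; exact: cvg_snd.
exact: (cvg_pair A1 A2).
Qed.

Variable mu : {measure set (line_borel R n) -> \bar R}.
Hypothesis hmu : is_invariant_line_measure mu.

Section change_of_variables.
Variables (a : R) (QQ : (a%:M : 'M[R]_n.+1) *m a%:M^T = 1%:M) (v : 'rV[R]_n.+1).
Hypothesis a1 : a * a = 1.
Variable f : line_borel R n -> R.
Hypothesis fi : mu.-integrable [set: line_borel R n] (EFin \o f).

Let phi : line_borel R n -> line_borel R n := move_line v QQ.

(** Motion invariance says that the pushforward of [mu] is [mu]; the integral of the absolute value
    is carried over along it. *)
Lemma integrable_move : mu.-integrable [set: line_borel R n] (EFin \o (f \o phi)).
Proof.
have mphi := move_line_measurable QQ v a1.
have /integrableP[mf foo] := fi; apply/integrableP; split.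
  by apply: measurableT_comp mf _.
apply: le_lt_trans foo.
have -> : (\int[mu]_E `|(EFin \o (f \o phi)) E| =
    \int[pushforward mu phi]_(E in setT) `|(EFin \o f) E|)%E.
  rewrite (ge0_integral_pushforward mphi mu measurableT)//.
  exact: (measurableT_comp (@abse_measurable R setT) mf).
rewrite le_eqVlt; apply/orP; left; apply/eqP.
by apply: eq_measure_integral => A mA _; exact: hmu.1.
Qed.

Lemma integral_move :
  (\int[mu]_E (f (phi E))%:E = \int[mu]_E (f E)%:E)%E.
Proof.
have mphi := move_line_measurable QQ v a1.
have /integrableP[mf foo] := fi.
have := @integral_pushforward _ _ (line_borel R n) (line_borel R n) R phi mphi mu
  setT (EFin \o f) mf.
rewrite preimage_setT => /(_ integrable_move measurableT) => <-.
by apply: eq_measure_integral => A mA _; rewrite -(hmu.1 _ v QQ A mA).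
Qed.

End change_of_variables.

Lemma cap_translate K v E (QQ : (1%:M : 'M[R]_n.+1) *m 1%:M^T = 1%:M) :
  cap_line (translate K v) (move_line v QQ E) = translate (cap_line K E) v.
Proof.
apply: convex_body_ext; apply/seteqP; split => X /=.
  move=> [[Y KY <-] [Z EZ]]; rewrite mulmx1 => /addIr ZY.
  by exists Y => //; split => //; rewrite -ZY.
move=> [Y [KY EY] <-]; split; first by exists Y.
by exists Y => //; rewrite mulmx1.
Qed.

Lemma cap_flip K v E (QQ : ((-1)%:M : 'M[R]_n.+1) *m (-1)%:M^T = 1%:M) :
  cap_line (translate (flip K) v) (move_line v QQ E) =
  translate (flip (cap_line K E)) v.
Proof.
apply: convex_body_ext; apply/seteqP; split => X /=.
  move=> [[_ [Y KY <-] <-] [Z EZ]]; rewrite mul_mx_scalar scaleN1r => /addIr/oppr_inj ZY.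
  by exists (- Y) => //; exists Y => //; split => //; rewrite -ZY.
move=> [_ [Y [KY EY] <-] <-]; split; first by exists (- Y) => //; exists Y.
by exists Y => //; rewrite mul_mx_scalar scaleN1r.
Qed.

End motions.

(** * Chords of a convex body *)

Section segments.
Variables (R : realType) (n : nat).
Implicit Types z : 'M[R]_(2, n).

Local Notation r0 := (ord0 : 'I_2).
Local Notation r1 := (ord_max : 'I_2).

(** The rows of z are the end points; coding a segment by a matrix turns functions of segments into
    functions on a Euclidean space with its Borel sets. *)
Definition seg_set z : set 'rV[R]_n :=
  [set (1 - t) *: row r0 z + t *: row r1 z | t in [set t : R | 0 <= t <= 1]].

Lemma seg_compact z : compact (seg_set z).
Proof.
rewrite /seg_set (_ : [set t : R | 0 <= t <= 1] = `[0, 1]%classic); last first.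
  by apply/seteqP; split => t; rewrite /= in_itv.
apply: continuous_compact; last exact: segment_compact.
apply: continuous_subspaceT => t.
have := @cvgD R 'rV[R]_n _ (nbhs t) _ (fun t => (1 - t) *: row r0 z) (fun t => t *: row r1 z).
apply; apply: cvgZr_tmp; last exact: cvg_id.
by apply: cvgB; [exact: cvg_cst|exact: cvg_id].
Qed.

Lemma seg_convex z : convex_set (seg_set z : set (convex_lmodType 'rV[R]_n)).
Proof.
move=> x y l; rewrite !inE => -[s /andP[s0 s1] <-] [t /andP[t0 t1] <-].
have l0 : 0 <= l%:num by []; have l1 : l%:num <= 1 by [].
exists (l%:num * s + (1 - l%:num) * t).
  move: (l%:num) l0 l1 => a a0 a1; apply/andP; split; nra.
rewrite /conv/=; move: (l%:num) => a; apply/rowP => j.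
by rewrite !mxE /unstable.onem; ring.
Qed.

Definition seg z : convex_body R n := ConvexBody (@seg_compact z) (@seg_convex z).

Definition shift_mx (v : 'rV[R]_n) : 'M[R]_(2, n) := \matrix_(i, j) v 0 j.

(* [swap_rows (- z)] differs from [z] by a translation only: this is how a
   reflected segment is recognized as a translate of itself. *)
Definition swap_rows z : 'M[R]_(2, n) := \matrix_(i, j) z (rev_ord i) j.

Let rev0 : rev_ord r0 = r1. Proof. exact/val_inj. Qed.
Let rev1 : rev_ord r1 = r0. Proof. exact/val_inj. Qed.

Lemma seg_swap z : seg (swap_rows z) = seg z.
Proof.
have E i w : row i (swap_rows w) = row (rev_ord i) w by apply/rowP => j; rewrite !mxE.
have sub w : seg_set (swap_rows w) `<=` seg_set w.
  move=> _ [t /andP[t0 t1] <-]; exists (1 - t); first by apply/andP; split; lra.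
  rewrite !E subKr addrC.
  by rewrite rev0 rev1.
apply: convex_body_ext; apply/seteqP; split; first exact: sub.
rewrite /= -{1}(_ : swap_rows (swap_rows z) = z); first exact: sub.
by apply/matrixP => i j; rewrite !mxE rev_ordK.
Qed.

Lemma translate_seg z v : translate (seg z) v = seg (z + shift_mx v).
Proof.
have E i : row i (z + shift_mx v) = row i z + v by apply/rowP => j; rewrite !mxE.
apply: convex_body_ext; apply/seteqP; split => x /=.
  move=> [_ [t t01 <-] <-]; exists t => //; rewrite !E !scalerDr addrACA -scalerDl.
  by rewrite subrK scale1r.
move=> [t t01 <-]; exists ((1 - t) *: row r0 z + t *: row r1 z); first by exists t.
by rewrite !E !scalerDr addrACA -scalerDl subrK scale1r.
Qed.

Lemma flip_seg z : flip (seg z) = seg (- z).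
Proof.
have E i : row i (- z) = - row i z by apply/rowP => j; rewrite !mxE.
apply: convex_body_ext; apply/seteqP; split => x /=.
  by move=> [_ [t t01 <-] <-]; exists t => //; rewrite !E !scalerN opprD.
move=> [t t01 <-]; exists ((1 - t) *: row r0 z + t *: row r1 z); first by exists t.
by rewrite !E !scalerN opprD.
Qed.

(** Minus one end point is the other end point minus the sum of both, so the reflection acts as the
    translation by minus that sum. *)
Lemma swap_rows_opp z : swap_rows (- z) = z + shift_mx (- (row r0 z + row r1 z)).
Proof.
apply/matrixP => i j; rewrite !mxE.
have [->|->] : i = r0 \/ i = r1.
  by case: i => [[|[|//]]] i; [left|right]; exact/val_inj.
  by rewrite rev0 opprD addrA subrr add0r.
by rewrite rev1 opprD addrCA subrr addr0.
Qed.

(** Points with the same parameter t are close; n d is the crude bound of the Euclidean norm by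
    coordinates. This is the continuity of [seg]. *)
Lemma seg_hausdorff (z w : 'M[R]_(2, n)) (d : R) :
  0 <= d -> (forall i j, `|z i j - w i j| <= d) ->
  (hausdorff_dist (seg z) (seg w) <= (n%:R * d)%:E)%E.
Proof.
move=> d0.
have sub (y x : 'M[R]_(2, n)) : (forall i j, `|y i j - x i j| <= d) ->
    seg_set y `<=` mink_sum (seg x) (eball (n%:R * d)).
  move=> H _ [t /andP[t0 t1] <-]; exists ((1 - t) *: row r0 x + t *: row r1 x).
    by exists t; rewrite //= t0.
  exists ((1 - t) *: row r0 (y - x) + t *: row r1 (y - x)); last first.
    by apply/rowP => j; rewrite !mxE; ring.
  apply: enorm_le_sum => // j; rewrite !mxE.
  apply: le_trans (ler_normD _ _) _; rewrite !normrM (ger0_norm t0) ger0_norm; last lra.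
  have := H r0 j; have := H r1 j; move: `|_| `|_| => a b; nra.
move=> H; apply: ereal_inf_lbound; exists (n%:R * d) => //; split.
- by rewrite mulr_ge0.
- exact: sub.
- by apply: sub => i j; rewrite distrC.
Qed.

End segments.

Section chords.
Variables (R : realType) (n : nat) (K : convex_body R n.+1).
Implicit Types (E : line_borel R n) (i : 'I_n.+1).

Local Notation r0 := (ord0 : 'I_2).
Local Notation r1 := (ord_max : 'I_2).

Definition hits : set (line_borel R n) := [set E | (line_set E `&` K) !=set0].

(* The first nonzero coordinate of the direction orients the line;
   [reversed_coord i] holds when the i-th coordinate then decreases along it. *)
Definition reversed_coord i : set (line_borel R n) :=
  [set E | exists k : 'I_n.+1, (forall j : 'I_n.+1, (j < k)%N -> line_dir E 0 j = 0) /\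
    line_dir E 0 k * line_dir E 0 i < 0].

(* For a line missing K this is [sup set0 = 0]. *)
Definition chord_sup (sg : R) i E : R := sup [set sg * x 0 i | x in body_set (cap_line K E)].

(** Minimum (as minus the supremum of -x_i) and maximum of each coordinate over the chord depend
    measurably on E, but do not tell which extremes belong to the same end point. The orientation
    decides: row 0 is the start of the chord and takes the minimum unless the coordinate
    decreases. *)
Definition endpoints E : 'M[R]_(2, n.+1) :=
  \matrix_(r, i) if (r == r0) (+) (E \in reversed_coord i)
                 then - chord_sup (-1) i E else chord_sup 1 i E.

(** Rescaling the direction multiplies the product of two coordinates by a square, so its sign is a
    property of the line and defines an open set; the vanishing of coordinates defines closed
    ones. *)
Lemma measurable_reversed_coord i : measurable (reversed_coord i).
Proof.
have -> : reversed_coord i = \bigcup_(k in [set: 'I_n.+1])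
    (\bigcap_(j in [set j : 'I_n.+1 | (j < k)%N]) [set E : line_borel R n | line_dir E 0 j = 0]
     `&` [set E : line_borel R n | line_dir E 0 k * line_dir E 0 i < 0]).
  apply/seteqP; split => E /=.
    by move=> [k [H1 H2]]; exists k => //; split => // j; exact: H1.
  by move=> [k _ [H1 H2]]; exists k; split => // j; exact: H1.
have cc (j : 'I_n.+1) : continuous (fun u : 'rV[R]_n.+1 => u 0 j) by exact: coord_continuous.
apply: fin_bigcup_measurable => // k _; apply: measurableI.
  apply: fin_bigcap_measurable => // j _.
  rewrite -(setCK (mkset _)); apply: measurableC; apply: measurable_line_open.
  apply: (@line_open_dir R n (fun u => u 0 j <> 0)) => [c u /eqP c0 u0||].
  - by rewrite mxE => /eqP; rewrite mulf_eq0 => /orP[/eqP //|/eqP].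
  - by apply; rewrite mxE.
  apply: (@open_comp _ _ (fun u : 'rV[R]_n.+1 => u 0 j) (~` [set 0])) => [u _|].
    exact: cc.
  by rewrite openC; exact: closed_eq.
apply: measurable_line_open.
apply: (@line_open_dir R n (fun u => u 0 k * u 0 i < 0)) => [c u c0 u0||].
- rewrite !mxE mulrACA pmulr_rlt0//.
  by rewrite lt_neqAle eq_sym mulf_neq0//= -expr2 sqr_ge0.
- by rewrite mxE mul0r ltxx.
apply: (@open_comp _ _ (fun u : 'rV[R]_n.+1 => u 0 k * u 0 i) [set t | t < 0]) => [u _|].
  exact: (cvgM (cc k u) (cc i u)).
exact: open_lt.
Qed.

Let scaled_coord_continuous (sg : R) i :
  continuous (fun x : 'rV[R]_n.+1 => sg * x 0 i).
Proof. by move=> x; exact: (cvgM (cvg_cst sg) (@coord_continuous R 1 n.+1 0 i x)). Qed.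

Lemma chord_sup_attained (sg : R) i E : hits E -> exists2 x, body_set (cap_line K E) x &
  chord_sup sg i E = sg * x 0 i /\
  forall y, body_set (cap_line K E) y -> sg * y 0 i <= sg * x 0 i.
Proof.
move=> [x0 [Ex0 Kx0]].
have [||x /set_mem xC xmax] := @compact_EVT_max _ R
  (fun x : 'rV[R]_n.+1 => sg * x 0 i) _ _ (@body_compact _ _ (cap_line K E)).
- by exists x0.
- by apply: continuous_subspaceT => x; exact: scaled_coord_continuous.
have {}xmax y : body_set (cap_line K E) y -> sg * y 0 i <= sg * x 0 i.
  by move=> yC; apply: xmax; exact: mem_set.
exists x => //; split => //; apply/eqP; rewrite eq_le; apply/andP; split.
  apply: ge_sup; first by exists (sg * x 0 i); exists x.
  by move=> _ [y yC <-]; exact: xmax.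
apply: ub_le_sup; last by exists x.
by exists (sg * x 0 i) => _ [y yC <-]; exact: xmax.
Qed.

Lemma chord_sup_miss (sg : R) i E : ~ hits E -> chord_sup sg i E = 0.
Proof.
move=> nE; rewrite /chord_sup (_ : body_set (cap_line K E) = set0) ?image_set0 ?sup0//.
by rewrite -subset0 => x [Kx Ex]; apply: nE; exists x.
Qed.

(** As the supremum is attained, it is at least c exactly when E hits the compact part of K where sg
    x_i >= c. Lines missing K have the default value 0 and join in when c <= 0. *)
Lemma measurable_chord_sup sg i : measurable_fun [set: line_borel R n] (chord_sup sg i).
Proof.
apply: (measurability _ (RGenCInfty.measurableE R)) => //.
move=> _ [_ [c ->] <-]; rewrite setTI.
pose C := body_set K `&` [set x | c <= sg * x 0 i].
have cC : compact C.
  apply: compact_closedI; first exact: body_compact.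
  apply: (@preimage_closed _ _ (fun x : 'rV[R]_n.+1 => sg * x 0 i) [set t | c <= t]) => [x _|].
    exact: scaled_coord_continuous.
  exact: closed_ge.
have -> : chord_sup sg i @^-1` `[c, +oo[ = [set E : line_borel R n | (line_set E `&` C) !=set0] `|`
    (~` hits `&` [set E | c <= 0]).
  apply/seteqP; split => E; rewrite /= in_itv/= andbT.
    have [hE|nE] := pselect (hits E).
      have [x [Kx Ex] [-> _]] := chord_sup_attained sg i hE.
      by move=> cx; left; exists x.
    by rewrite chord_sup_miss//; right.
  move=> [[x [Ex [Kx /= cx]]]|[nE c0]].
    have hE : hits E by exists x.
    have [y _ [-> ymax]] := chord_sup_attained sg i hE.
    by apply: le_trans cx _; exact: ymax.
  by rewrite chord_sup_miss.
apply: measurableU; first exact: measurable_hits.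
apply: measurableI; first by apply: measurableC; apply: measurable_hits; exact: body_compact.
have [c0|c0] := boolP (c <= 0).
  by rewrite (_ : mkset _ = setT)//; apply/seteqP; split => //.
by rewrite (_ : mkset _ = set0)//; apply/seteqP; split => //.
Qed.

Lemma measurable_endpoints r i : measurable_fun [set: line_borel R n] (fun E => endpoints E r i).
Proof.
rewrite (_ : (fun _ => _) = fun E => if (r == r0) (+) (E \in reversed_coord i)
    then - chord_sup (-1) i E else chord_sup 1 i E); last by apply/funext => E; rewrite mxE.
apply: measurable_fun_ifT.
- apply: (@measurable_fun_bool _ _ _ _ (r != r0)).
  have mN := measurable_reversed_coord i.
  rewrite setTI (_ : _ @^-1` _ = reversed_coord i)//; apply/seteqP; split => E /=.
    by case: (r == r0) => /=; case: (boolP (E \in reversed_coord i)) => // /set_mem.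
  by move=> /mem_set ->; case: (r == r0).
- by apply: measurable_funN; exact: measurable_chord_sup.
- exact: measurable_chord_sup.
Qed.

Lemma line_orientation E : exists p u, line_set E = affine_line p u /\
  u != 0 /\ forall i, (E \in reversed_coord i) = (u 0 i < 0).
Proof.
have [d0 dE] := line_dirP E.
have [k dk kmin] : exists2 k : 'I_n.+1, line_dir E 0 k != 0 &
    forall j : 'I_n.+1, (j < k)%N -> line_dir E 0 j = 0.
  have [k0 dk0] : exists k, line_dir E 0 k != 0.
    apply/existsP; rewrite -negb_forall; apply: contraNN d0 => /forallP d0.
    by apply/eqP/rowP => j; rewrite mxE; exact/eqP.
  case: (@arg_minnP _ k0 (fun k => line_dir E 0 k != 0) (fun k => val k) dk0) => k dk kmin.
  exists k => // j jk; apply/eqP; apply: contraTT jk => dj; rewrite -leqNgt.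
  exact: kmin.
(* Scaling by the first nonzero coordinate makes that coordinate positive, and turns the sign
   condition of [reversed_coord] into the sign of u_i. *)
exists (line_pt E), (line_dir E 0 k *: line_dir E); split; last split.
- rewrite dE; apply/seteqP; split => [_ [t _ <-]|_ [t _ <-]].
    by exists (t / line_dir E 0 k) => //; rewrite scalerA divfK.
  by exists (t * line_dir E 0 k) => //; rewrite scalerA.
- by rewrite scaler_eq0 negb_or dk.
move=> i; rewrite mxE; apply/idP/idP => [/set_mem [k' [k'min k'i]]|ki]; last first.
  by apply/mem_set; exists k.
suff <- : k' = k by [].
have dk' : line_dir E 0 k' != 0 by apply: contraTneq k'i => ->; rewrite mul0r ltxx.
apply/val_inj/eqP; rewrite eqn_leq; apply/andP; split; rewrite leqNgt; apply/negP.
  by move=> /k'min/eqP; rewrite (negbTE dk).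
by move=> /kmin/eqP; rewrite (negbTE dk').
Qed.

(** The points a and b where <x, u> is least and greatest bound the chord. Each coordinate is
    monotone in the parameter t, increasing or decreasing with the sign of u_i, so its extremes are
    attained at a and b in the order recorded by [endpoints]. *)
Lemma cap_line_seg E : hits E -> cap_line K E = seg (endpoints E).
Proof.
move=> hE; have [p [u [Epu [u0 negu]]]] := line_orientation E.
pose C := body_set (cap_line K E).
have C0 : C !=set0 by case: hE => x [Ex Kx]; exists x.
have uu : 0 < dot u u.
  rewrite lt_neqAle dot_ge0 andbT eq_sym.
  by apply: contra_neq u0 => uu; apply: dot_eq0; rewrite uu.
have cd : {within C, continuous (fun x => dot x u)}.
  by apply: continuous_subspaceT; exact: continuous_dotl.
have [a /set_mem aC amin] := compact_EVT_min C0 (@body_compact _ _ (cap_line K E)) cd.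
have [b /set_mem bC bmax] := compact_EVT_max C0 (@body_compact _ _ (cap_line K E)) cd.
have par x : C x -> exists t, x = p + t *: u.
  by move=> [_]; rewrite Epu => -[t _ <-]; exists t.
have [ta aE] := par a aC; have [tb bE] := par b bC.
have dotE t : dot (p + t *: u) u = dot p u + t * dot u u by rewrite dotDl dotZl.
have between x : C x -> exists2 t, ta <= t <= tb & x = p + t *: u.
  move=> xC; have [t xE] := par x xC; exists t => //; apply/andP; split.
    by have := amin x (mem_set xC); rewrite aE xE !dotE lerD2l ler_pM2r.
  by have := bmax x (mem_set xC); rewrite bE xE !dotE lerD2l ler_pM2r.
have tab : ta <= tb by have [t /andP[h1 h2] _] := between a aC; exact: le_trans h1 h2.
have topE sg i x : C x -> (forall y, C y -> sg * y 0 i <= sg * x 0 i) ->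
    chord_sup sg i E = sg * x 0 i.
  move=> xC xmax; have [y yC [-> ymax]] := chord_sup_attained sg i hE.
  by apply/eqP; rewrite eq_le xmax//=; exact: ymax.
have coordE t i : (p + t *: u) 0 i = p 0 i + t * u 0 i by rewrite !mxE.
have rowa : row r0 (endpoints E) = a.
  apply/rowP => i; rewrite !mxE negu /=.
  have [ui|ui] /= := ltP (u 0 i) 0.
    rewrite (topE 1 i a aC) ?mul1r// => y /between[t /andP[t1 t2] ->].
    by rewrite !mul1r aE !coordE; nra.
  rewrite (topE (-1) i a aC) ?mulN1r ?opprK// => y /between[t /andP[t1 t2] ->].
  by rewrite !mulN1r aE !coordE; nra.
have rowb : row r1 (endpoints E) = b.
  apply/rowP => i; rewrite !mxE negu /=.
  have [ui|ui] /= := ltP (u 0 i) 0.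
    rewrite (topE (-1) i b bC) ?mulN1r ?opprK// => y /between[t /andP[t1 t2] ->].
    by rewrite !mulN1r bE !coordE; nra.
  rewrite (topE 1 i b bC) ?mul1r// => y /between[t /andP[t1 t2] ->].
  by rewrite !mul1r bE !coordE; nra.
apply: convex_body_ext; apply/seteqP; split => x.
  move=> /between[t /andP[t1 t2] ->]; rewrite /= /seg_set/= rowa rowb aE bE.
  (* A chord reduced to one point, where the parameter cannot be normalized by tb - ta. *)
  have [tt|tt] := eqVneq ta tb.
    exists 0; first by rewrite lexx ler01.
    rewrite scale0r subr0 scale1r addr0; congr (_ + _ *: _).
    by apply/eqP; rewrite eq_le t1 tt.
  have tlt : 0 < tb - ta by rewrite subr_gt0 lt_neqAle tt.
  exists ((t - ta) / (tb - ta)).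
    by rewrite divr_ge0 ?subr_ge0// ler_pdivrMr// mul1r lerD2r.
  apply/rowP => i; rewrite !mxE; field.
  by rewrite gt_eqF.
move=> [t /andP[t0 t1] <-]; rewrite rowa rowb.
have := @body_convex _ _ (cap_line K E) a b (Itv01 (_ : 0 <= 1 - t) (_ : 1 - t <= 1)).
have ht0 : 0 <= 1 - t by rewrite subr_ge0.
have ht1 : 1 - t <= 1 by rewrite gerBl.
move=> /(_ ht0 ht1 (mem_set aC) (mem_set bC)); rewrite inE /conv/=.
by rewrite /unstable.onem subKr.
Qed.

End chords.

Section borel_matrices.
Variables (R : realType) (m n : nat).
Local Notation M := 'M[R]_(m, n).

Lemma measurable_coord i j : measurable_fun [set: borel M] (fun z : borel M => z i j).
Proof.
apply: sigma_algebra_measurable_fun => x.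
apply: (@open_comp _ _ (fun z : M => z i j)) => [z _|]; last exact: interval_open.
exact: coord_continuous.
Qed.

(** The Borel sets are generated by the open sets, not by coordinates: each open set is a countable
    union of cubes with rational centre and radius 1 / (k + 1). *)
Lemma measurable_to_matrix d (T : measurableType d) (f : T -> borel M) :
  (forall i j, measurable_fun [set: T] (fun t => f t i j)) ->
  measurable_fun [set: T] f.
Proof.
move=> mf; apply: (@measurability _ _ T (borel M) setT f (@open M)) => //.
move=> _ [U oU <-]; rewrite setTI.
pose B (qk : 'M[rat]_(m, n) * nat) : set M :=
  [set z | forall i j, `|z i j - ratr (qk.1 i j)| < qk.2.+1%:R^-1].
have -> : f @^-1` U = \bigcup_(qk in [set qk | B qk `<=` U]) (f @^-1` B qk).
  apply/seteqP; split => t /=; last by move=> [qk BU Bt]; exact: BU.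
  move=> Uft; have : nbhs (f t) U by apply: open_nbhs_nbhs.
  move=> /nbhs_ballP[e /= e0 eU].
  (* Twice the radius must stay below e, since the centre of the cube is only near f t. *)
  have [k ke] : exists k : nat, 2 * k.+1%:R^-1 < e.
    exists (Num.truncn (2 / e)); rewrite mulrC -ltr_pdivlMr// invf_plt ?posrE ?divr_gt0//.
    by rewrite invf_div; exact: truncnS_gt.
  have k0 : 0 < k.+1%:R^-1 :> R by rewrite invr_gt0.
  have H i j : exists q : rat, `|f t i j - ratr q| < k.+1%:R^-1.
    have := @rat_in_itvoo R (f t i j - k.+1%:R^-1) (f t i j + k.+1%:R^-1).
    have -> : f t i j - k.+1%:R^-1 < f t i j + k.+1%:R^-1 by move: k0; set a := _^-1; lra.
    move=> /(_ isT)[q]; rewrite in_itv/= => /andP[q1 q2]; exists q.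
    rewrite ltr_norml; move: q1 q2; set a := _^-1; set b := ratr q => q1 q2.
    by apply/andP; split; lra.
  pose q : 'M[rat]_(m, n) := \matrix_(i, j) projT1 (cid (H i j)).
  have Hq i j : `|f t i j - ratr (q i j)| < k.+1%:R^-1.
    by rewrite mxE; case: cid.
  exists (q, k) => //= z Bz; apply: eU; split=> // i j.
  rewrite /ball/=; have -> : f t i j - z i j =
    (f t i j - ratr (q i j)) - (z i j - ratr (q i j)) by ring.
  apply: le_lt_trans (ler_normB _ _) _; have := Hq i j; have := Bz i j; rewrite /=.
  by move: ke; set a := _^-1; move: `|_| `|_| => b c; lra.
rewrite bigcup_mkcond; apply: countable_bigcupT_measurable => // qk.
case: ifP => // _.
rewrite (_ : _ @^-1` _ = \bigcap_(i in [set: 'I_m]) \bigcap_(j in [set: 'I_n])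
    [set t | `|f t i j - ratr (qk.1 i j)| < qk.2.+1%:R^-1]); last first.
  by apply/seteqP; split => t /= H i; [move=> _ j _|move=> j]; exact: H.
apply: fin_bigcap_measurable => // i _; apply: fin_bigcap_measurable => // j _.
have mg : measurable_fun [set: T] (fun t => `|f t i j - ratr (qk.1 i j)|).
  by apply: measurableT_comp => //; apply: measurable_funB.
have := mg measurableT `]-oo, qk.2.+1%:R^-1[%classic (measurable_itv _); rewrite setTI.
by congr (measurable _); apply/seteqP; split => t; rewrite /= in_itv/=.
Qed.

End borel_matrices.

Lemma measurable_seg (R : realType) (n : nat) :
  measurable_fun [set: borel 'M[R]_(2, n)] (@seg R n : borel 'M[R]_(2, n) -> body_borel R n).
Proof.
apply: (@measurability _ _ (borel 'M[R]_(2, n)) (body_borel R n) _ _ (@hausdorff_open R n)) => //.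
move=> _ [U oU <-]; rewrite setTI; apply: sub_sigma_algebra.
rewrite openE => z Uz; have [e e0 He] := oU _ Uz.
(* Dividing by n + 1 makes n times the quotient strictly less than e, and also covers n = 0. *)
apply/nbhs_ballP; have d0 : 0 < e / n.+1%:R by rewrite divr_gt0.
exists (e / n.+1%:R) => //= w [_ zw]; apply: He.
apply: (le_lt_trans (seg_hausdorff (ltW d0) _)) => [i j|].
  by apply: ltW; exact: zw.
by rewrite lte_fin mulrA ltr_pdivrMr// mulrC ltr_pM2l// ltr_nat.
Qed.

(** * Averaging over translations *)

Section lebesgue_translation.
Variable R : realType.
Notation leb := (@lebesgue_measure R).
Local Open Scope ereal_scope.

(** The pushforward of Lebesgue measure under a translation agrees with it on half-open intervals,
    hence everywhere by uniqueness. *)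
Lemma ge0_integral_translate (f : R -> \bar R) (y : R) :
  measurable_fun [set: R] f -> (forall t, 0 <= f t) ->
  \int[leb]_t f (t + y)%R = \int[leb]_t f t.
Proof.
move=> mf f0.
pose phi : measurableTypeR R -> measurableTypeR R := fun t => (t + y)%R.
have mphi : measurable_fun setT phi by apply: measurable_funD.
have -> : \int[leb]_t f (t + y)%R = \int[pushforward leb phi]_t f t.
  by rewrite (ge0_integral_pushforward mphi leb measurableT).
apply: eq_measure_integral => A mA _; apply/esym.
apply: (@lebesgue_measure_unique R (pushforward leb phi)) => //= _ [[a b]] _ <-.
rewrite /pushforward.
have -> : phi @^-1` [set` Interval (BRight a) (BRight b)] = `]a - y, b - y]%classic%R.
  by apply/seteqP; split => t; rewrite /= !in_itv/= ltrBlDr lerBrDr.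
rewrite !lebesgue_measure_itv/= !lte_fin ltrD2r.
by case: ifP => // _; rewrite -!EFinB; congr (_%:E); ring.
Qed.

(* Moving the window [0, r] by y uncovers a set of measure at most |y|. *)
Lemma window_integral_shift (b : R -> R) (C r y : R) :
  measurable_fun [set: R] b -> (forall t, 0 <= b t <= C)%R -> (0 <= r)%R ->
  \int[leb]_t (b (t + y) * \1_`[0, r] t)%:E <=
  \int[leb]_t (b t * \1_`[0, r] t)%:E + (C * `|y|)%:E.
Proof.
move=> mb bC r0.
have C0 : (0 <= C)%R by have /andP[h1 h2] := bC 0%R; exact: le_trans h1 h2.
have b0 t : (0 <= b t)%R by have /andP[] := bC t.
have i0 (A : set R) t : (0 <= \1_A t :> R)%R by rewrite indicE.
pose f t := (b t * \1_`[0, r] (t - y))%:E.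
have mi (A : set R) : measurable A -> measurable_fun [set: R] (\1_A : R -> R).
  by move=> mA; exact: measurable_indic.
have mf : measurable_fun [set: R] f.
  apply/measurable_EFinP; apply: measurable_funM => //.
  by apply: (measurableT_comp (mi _ (measurable_itv _))); apply: measurable_funB.
have f0 t : 0 <= f t by rewrite lee_fin mulr_ge0.
rewrite (_ : \int[leb]_t (b (t + y) * _)%:E = \int[leb]_t f (t + y)%R); last first.
  by apply: eq_integral => t _; rewrite /f addrK.
rewrite ge0_integral_translate//.
(* Contains the part of the moved window [y, r + y] outside [0, r], on the side given by the sign of
   y, and has measure exactly |y|. *)
pose S : set R := if (0 <= y)%R then `]r, (r + y)%R]%classic else `[y, 0%R[%classic.
have mS : measurable S by rewrite /S; case: ifP.
have lS : leb S = `|y|%:E.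
  rewrite /S; case: (leP 0%R y) => y0; rewrite lebesgue_measure_itv/= lte_fin.
    rewrite ltrDl; case: ltgtP y0 => // [y0|<-] _.
      by rewrite -EFinB gtr0_norm//; congr (_%:E); ring.
    by rewrite normr0.
  by rewrite y0 -EFinB sub0r ltr0_norm.
apply: (@le_trans _ _ (\int[leb]_t ((b t * \1_`[0, r] t)%:E + (C * \1_S t)%:E))).
  apply: le_integral_nonmeasurable => // t; rewrite /f -EFinD lee_fin.
  have /andP[bt0 btC] := bC t.
  rewrite !indicE /S; case: (boolP (t - y \in _)%R) => [|_]; last first.
    by rewrite mulr0 addr_ge0// mulr_ge0.
  rewrite inE/= in_itv/= => /andP[t0 tr].
  case: (boolP (t \in `[0%R, r]%classic)) => [_|].
    by rewrite lerDl mulr_ge0.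
  rewrite notin_setE/= in_itv/= => /negP; rewrite negb_and -!ltNge => ht.
  rewrite mulr0 add0r mem_set ?mulr1//.
  case: (leP 0%R y) => y0; rewrite /= in_itv/=; apply/andP; split; case/orP: ht => ht; lra.
rewrite ge0_integralD//; last 4 first.
- by move=> t _; rewrite lee_fin mulr_ge0.
- by apply/measurable_EFinP; apply: measurable_funM => //; exact: mi.
- by move=> t _; rewrite lee_fin mulr_ge0.
- by apply/measurable_EFinP; apply: measurable_funM => //; exact: mi.
rewrite leeD2l// integralZl_indic//=; last by move=> /lt_geF; rewrite C0.
by rewrite integral_indic// setIT [X in C%:E * X]lS EFinM.
Qed.

End lebesgue_translation.

Section averaging.
Variables (R : realType) (n : nat).
Local Notation V := 'M[R]_(2, n).
Local Notation leb := (@lebesgue_measure R).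
Implicit Types (beta : V -> R) (j k : 'I_n).

Definition shift_along (j : 'I_n) (t : R) : V := shift_mx (t *: 'e_j).

Lemma shift_alongE j t i k : shift_along j t i k = t * (k == j)%:R.
Proof. by rewrite !mxE eqxx. Qed.

Lemma shift_alongD j s t : shift_along j (s + t) = shift_along j s + shift_along j t.
Proof. by apply/matrixP => i k; rewrite [RHS]mxE !shift_alongE mulrDl. Qed.

(** Nonnegativity gives access to Tonelli and to monotonicity of integrals without integrability
    side conditions. *)
Definition bounded_test_fun (C : R) beta :=
  measurable_fun [set: borel V] (beta : borel V -> R) /\ forall z, 0 <= beta z <= C.

Definition window_avg (r : R) j beta (z : V) : R :=
  r^-1 * \int[leb]_t (beta (z + shift_along j t) * \1_`[0, r] t).

(** The extended real form of the window integral, on which Tonelli and comparison operate;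
    [avgi_avg] relates it to [window_avg]. *)
Let avgi (r : R) j beta (z : V) : \bar R :=
  (\int[leb]_t (beta (z + shift_along j t) * \1_`[0, r] t)%:E)%E.

Lemma measurable_shifted d (T : measurableType d) (z : T -> V) j C beta :
  (forall i k, measurable_fun [set: T] (fun t => z t i k)) -> bounded_test_fun C beta ->
  measurable_fun [set: T * measurableTypeR R]
    (fun p : T * measurableTypeR R => beta (z p.1 + shift_along j p.2)).
Proof.
move=> mz [mb _].
have mg : measurable_fun [set: T * measurableTypeR R]
    (fun p : T * measurableTypeR R => z p.1 + shift_along j p.2 : borel V); last first.
  exact: (measurableT_comp mb mg).
apply: measurable_to_matrix => i k.
rewrite (_ : (fun _ => _) =
    (fun p : T * measurableTypeR R => z p.1 i k + p.2 * (k == j)%:R)); last first.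
  by apply/funext => p; rewrite mxE shift_alongE.
apply: measurable_funD.
  exact: (measurableT_comp (mz i k) measurable_fst).
by apply: measurable_funM => //; exact: measurable_snd.
Qed.

Lemma measurable_test_shift d (T : measurableType d) (z : T -> V) (x : V) C beta :
  (forall i k, measurable_fun [set: T] (fun t => z t i k)) -> bounded_test_fun C beta ->
  measurable_fun [set: T] (fun t => beta (z t + x)).
Proof.
move=> mz [mb _].
have mg : measurable_fun [set: T] (fun t => z t + x : borel V); last first.
  exact: (measurableT_comp mb mg).
apply: measurable_to_matrix => i k.
rewrite (_ : (fun _ => _) = fun t => z t i k + x i k); last by apply/funext => t; rewrite mxE.
exact: measurable_funD.
Qed.

Lemma measurable_window d (T : measurableType d) (r : R) :
  measurable_fun [set: T * measurableTypeR R]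
    (fun p : T * measurableTypeR R => \1_`[0, r] p.2 : R).
Proof.
have mi : measurable_fun [set: measurableTypeR R] (\1_`[0, r] : R -> R).
  exact: measurable_indic.
exact: (measurableT_comp mi measurable_snd).
Qed.

Section fixed_average.
Variables (C r : R) (j : 'I_n) (beta : V -> R).
Hypotheses (r0 : 0 < r) (hb : bounded_test_fun C beta).

Let C0 : 0 <= C.
Proof. by have /andP[h1 h2] := hb.2 0; exact: le_trans h1 h2. Qed.

Let b0 z : 0 <= beta z. Proof. by have /andP[] := hb.2 z. Qed.

Let i0 (A : set R) t : 0 <= \1_A t :> R. Proof. by rewrite indicE. Qed.

Let measurable_line z : measurable_fun [set: R] (fun t : R => beta (z + shift_along j t)).
Proof.
have ms := @measurable_shifted _ (measurableTypeR R) (fun=> z) j C beta _ hb.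
have {}ms := ms (fun i k => measurable_cst _).
have mp : measurable_fun [set: measurableTypeR R]
  (fun t : measurableTypeR R => (0 : measurableTypeR R, t)).
  by apply: measurable_fun_pair.
exact: (measurableT_comp ms mp).
Qed.

Lemma integral_window (a : R) : 0 <= a ->
  (\int[leb]_t (a * \1_`[0%R, r] t)%:E = (a * r)%:E)%E.
Proof. by move=> a0; rewrite integral_cst_itv ?(ltW r0)// subr0 mulrC. Qed.

Lemma avgi_bounds z : (0 <= avgi r j beta z <= (C * r)%:E)%E.
Proof.
apply/andP; split; first by apply: integral_ge0 => t _; rewrite lee_fin mulr_ge0.
rewrite -integral_window//; apply: le_integral_nonmeasurable => t; rewrite lee_fin.
  by rewrite mulr_ge0.
by rewrite ler_wpM2r//; have /andP[] := hb.2 (z + shift_along j t).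
Qed.

Lemma avgiE z : (window_avg r j beta z)%:E = (r^-1%:E * avgi r j beta z)%E.
Proof.
rewrite /window_avg EFinM fineK//; have /andP[h1 h2] := avgi_bounds z.
by rewrite ge0_fin_numE//; exact: le_lt_trans h2 (ltry _).
Qed.

Lemma avgi_avg z : avgi r j beta z = (r * window_avg r j beta z)%:E.
Proof. by rewrite EFinM avgiE muleA -EFinM mulfV ?gt_eqF// mul1e. Qed.

Lemma avg_test : bounded_test_fun C (window_avg r j beta).
Proof.
split=> [|z]; last first.
  have := avgi_bounds z; rewrite avgi_avg !lee_fin (mulrC C).
  by rewrite pmulr_rge0// ler_pM2l.
apply/measurable_EFinP.
rewrite (_ : _ \o _ = fun z => (r^-1%:E * avgi r j beta z)%E); last first.
  by apply/funext => z; rewrite /= avgiE.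
apply: measurable_funeM.
have mz i k : measurable_fun [set: borel V] (fun t : borel V => id t i k) by exact: measurable_coord.
apply: (@measurable_fun_fubini_tonelli_F _ _ (borel V) (measurableTypeR R) R leb
  (fun p => (beta (p.1 + shift_along j p.2) * \1_`[0, r] p.2)%:E)) => [|p].
  apply/measurable_EFinP; apply: measurable_funM; first exact: (measurable_shifted j mz hb).
  exact: measurable_window.
by rewrite lee_fin mulr_ge0.
Qed.

(** A translation along the averaged direction only moves the window, which changes the integral by
    at most C |y| before division by r. *)
Lemma avg_shift_dir z y :
  window_avg r j beta (z + shift_along j y) <= window_avg r j beta z + C / r * `|y|.
Proof.
have := @window_integral_shift R (fun t => beta (z + shift_along j t)) C r y (measurable_line z)
  (fun t => hb.2 _) (ltW r0).
rewrite -/(avgi r j beta z).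
rewrite (_ : (\int[leb]_t _)%E = avgi r j beta (z + shift_along j y)); last first.
  by apply: eq_integral => t _; rewrite (addrC t) shift_alongD addrA.
rewrite !avgi_avg -EFinD lee_fin => H.
rewrite -(ler_pM2l r0); apply: le_trans H _; rewrite mulrDr lerD2l.
by rewrite mulrA mulrCA divff ?gt_eqF// mulr1.
Qed.

(** A later average along j does not spoil the estimate already gained along k: the pointwise
    inequality is averaged. *)
Lemma avg_shift_other k e : 0 <= e ->
  (forall z y, beta (z + shift_along k y) <= beta z + e * `|y|) ->
  forall z y, window_avg r j beta (z + shift_along k y) <= window_avg r j beta z + e * `|y|.
Proof.
move=> e0 H z y; rewrite -(ler_pM2l r0) -lee_fin mulrDr EFinD -!avgi_avg.
have -> : (r * (e * `|y|))%:E = (\int[leb]_t (e * `|y| * \1_`[0%R, r] t)%:E)%E.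
  by rewrite integral_window ?mulr_ge0// mulrC.
rewrite /avgi -ge0_integralD//; last 4 first.
- by move=> t _; rewrite lee_fin mulr_ge0.
- by apply/measurable_EFinP; apply: measurable_funM; [exact: measurable_line|exact: measurable_indic].
- by move=> t _; rewrite lee_fin !mulr_ge0.
- by apply/measurable_EFinP; apply: measurable_funM => //; exact: measurable_indic.
apply: le_integral_nonmeasurable => t; first by rewrite lee_fin mulr_ge0.
by rewrite -EFinD lee_fin -mulrDl ler_wpM2r// addrAC.
Qed.

Section gap.
Context d (T : measurableType d) (nu : {finite_measure set T -> \bar R}).
Implicit Types z w : T -> V.

Lemma integral_avg z x : (forall i k, measurable_fun [set: T] (fun t => z t i k)) ->
  (\int[nu]_E (window_avg r j beta (z E + x))%:E =
   r^-1%:E * \int[leb]_t ((\int[nu]_E (beta (z E + (x + shift_along j t)))%:E)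
     * (\1_`[0%R, r] t)%:E))%E.
Proof.
move=> mz.
have mz' i k : measurable_fun [set: T] (fun t => (z t + x) i k).
  rewrite (_ : (fun _ => _) = fun t => z t i k + x i k); last by apply/funext => t; rewrite mxE.
  exact: measurable_funD.
have mf : measurable_fun [set: T * measurableTypeR R]
    (fun p : T * measurableTypeR R => (beta (z p.1 + x + shift_along j p.2) * \1_`[0, r] p.2)%:E).
  apply/measurable_EFinP; apply: measurable_funM; last exact: measurable_window.
  exact: (measurable_shifted j mz' hb).
have f0 (p : T * measurableTypeR R) :
    (0 <= (beta (z p.1 + x + shift_along j p.2) * \1_`[0, r] p.2)%:E)%E.
  by rewrite lee_fin mulr_ge0.
under eq_integral do rewrite avgiE.
rewrite ge0_integralZl//; last 3 first.
- exact: (measurable_fun_fubini_tonelli_F _ mf f0).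
- by move=> t _; have /andP[] := avgi_bounds (z t + x).
- by rewrite lee_fin invr_ge0 ltW.
congr (_ * _)%E; rewrite /avgi (fubini_tonelli _ mf f0).
apply: eq_integral => t _; rewrite /= /fubini_G /=.
under eq_integral do rewrite EFinM.
rewrite ge0_integralZr//.
- by congr (_ * _)%E; apply: eq_integral => E _; rewrite addrA.
- by apply/measurable_EFinP; apply: (measurable_test_shift _ mz' hb).
- by move=> E _; rewrite lee_fin.
Qed.

Lemma measurable_integral_shift z (x : V) :
  (forall i k, measurable_fun [set: T] (fun t => z t i k)) ->
  measurable_fun [set: R] (fun t : R => \int[nu]_E (beta (z E + (x + shift_along j t)))%:E)%E.
Proof.
move=> mz.
have mz' i k : measurable_fun [set: T] (fun t => (z t + x) i k).
  rewrite (_ : (fun _ => _) = fun t => z t i k + x i k); last by apply/funext => t; rewrite mxE.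
  exact: measurable_funD.
have mf : measurable_fun [set: T * measurableTypeR R]
    (fun p : T * measurableTypeR R => (beta (z p.1 + x + shift_along j p.2))%:E).
  by apply/measurable_EFinP; exact: (measurable_shifted j mz' hb).
have f0 (p : T * measurableTypeR R) :
    (0 <= (beta (z p.1 + x + shift_along j p.2))%:E)%E by rewrite lee_fin.
rewrite (_ : (fun _ => _) = fun t => (\int[nu]_E (beta (z E + x + shift_along j t))%:E)%E).
  exact: (measurable_fun_fubini_tonelli_G _ mf f0).
by apply/funext => t; apply: eq_integral => E _; rewrite addrA.
Qed.

(** The gap at v + t e_j, for each t in the window, is averaged over t; c is its own average. The
    quantification over all v makes the statement reproduce itself. *)
Lemma gap_avg (c : R) z w : 0 <= c ->
  (forall i k, measurable_fun [set: T] (fun t => z t i k)) ->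
  (forall i k, measurable_fun [set: T] (fun t => w t i k)) ->
  (forall v, (c%:E + \int[nu]_E (beta (w E + shift_mx v))%:E <=
    \int[nu]_E (beta (z E + shift_mx v))%:E)%E) ->
  forall v, (c%:E + \int[nu]_E (window_avg r j beta (w E + shift_mx v))%:E <=
    \int[nu]_E (window_avg r j beta (z E + shift_mx v))%:E)%E.
Proof.
move=> c0 mz mw H v; rewrite !integral_avg//.
have -> : c%:E = (r^-1%:E * \int[leb]_t (c * \1_`[0%R, r] t)%:E)%E.
  by rewrite integral_window// -EFinM mulrCA mulVf ?gt_eqF// mulr1.
have i0' t : (0 <= ((\1_`[0%R, r] t)%:E : \bar R))%E by rewrite lee_fin.
have J0 (u : T -> V) x : (0 <= \int[nu]_E (beta (u E + x))%:E)%E.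
  by apply: integral_ge0 => E _; rewrite lee_fin.
rewrite -ge0_muleDr ?integral_ge0//; last 2 first.
- by move=> t _; rewrite lee_fin mulr_ge0.
- by move=> t _; rewrite mule_ge0.
apply: lee_wpmul2l; first by rewrite lee_fin invr_ge0 ltW.
rewrite -ge0_integralD//; last 4 first.
- by move=> t _; rewrite lee_fin mulr_ge0.
- by apply/measurable_EFinP; apply: measurable_funM => //; exact: measurable_indic.
- by move=> t _; rewrite mule_ge0.
- apply: emeasurable_funM; first exact: measurable_integral_shift.
  by apply/measurable_EFinP; exact: measurable_indic.
apply: le_integral_nonmeasurable => t.
  by rewrite adde_ge0 ?mule_ge0// lee_fin mulr_ge0.
rewrite EFinM -ge0_muleDl ?lee_fin// lee_wpmul2r//.
have -> : shift_mx v + shift_along j t = shift_mx (v + t *: 'e_j).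
  by apply/matrixP => i k; rewrite [LHS]mxE shift_alongE !mxE eqxx.
exact: H.
Qed.

End gap.
End fixed_average.

Section iterated_average.
Context d (T : measurableType d) (nu : {finite_measure set T -> \bar R}).
Variables (z w : T -> V) (C c : R).
Hypothesis mz : forall i k, measurable_fun [set: T] (fun t => z t i k).
Hypothesis mw : forall i k, measurable_fun [set: T] (fun t => w t i k).
Hypothesis c0 : 0 <= c.

Let gap beta := forall v, (c%:E + \int[nu]_E (beta (w E + shift_mx v))%:E <=
    \int[nu]_E (beta (z E + shift_mx v))%:E)%E.

Lemma iterated_average r beta (l : seq 'I_n) : 0 < r -> bounded_test_fun C beta -> gap beta ->
  exists gamma, [/\ bounded_test_fun C gamma, gap gamma & forall k, k \in l ->
    forall x y, gamma (x + shift_along k y) <= gamma x + C / r * `|y|].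
Proof.
move=> r0 hb gb; elim: l => [|j l [gamma [hg gg lg]]]; first by exists beta.
have Cr0 : 0 <= C / r.
  rewrite divr_ge0 ?(ltW r0)//; have /andP[h1 h2] := hb.2 0; exact: le_trans h1 h2.
exists (window_avg r j gamma); split; [exact: avg_test|exact: (gap_avg j r0 hg c0 mz mw gg)|].
move=> k; rewrite inE => /orP[/eqP ->|kl]; first exact: avg_shift_dir.
exact: (avg_shift_other j r0 hg Cr0 (lg k kl)).
Qed.

(* Averaging keeps the gap c, while the averaged function varies by at most
   C / r per unit of translation; let r tend to infinity. *)
Lemma bounded_shift_gap beta (y : T -> 'rV[R]_n) (D : R) :
  bounded_test_fun C beta -> gap beta -> (forall E, z E = w E + shift_mx (y E)) ->
  (forall E k, `|y E 0 k| <= D) -> c = 0.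
Proof.
move=> hb gb zw yD; apply/eqP; rewrite eq_le c0 andbT leNgt; apply/negP => cpos.
have C0 : 0 <= C by have /andP[h1 h2] := hb.2 0; exact: le_trans h1 h2.
pose m := fine (nu setT).
have m0 : 0 <= m by rewrite fine_ge0.
have nuT : nu setT = m%:E by rewrite fineK// fin_num_measure.
pose D' := Num.max D 0.
have D0 : 0 <= D' by rewrite le_max lexx orbT.
have yD' E k : `|y E 0 k| <= D' by rewrite le_max yD.
(* With q = n C D' m, the total change e m becomes q c / (q + 1), strictly less than c. *)
pose r := (n%:R * (C * D') * m + 1) / c.
have r0 : 0 < r by rewrite divr_gt0// ltr_wpDl// !mulr_ge0.
have [gamma [hg gg lg]] := iterated_average (enum 'I_n) r0 hb gb.
pose e := n%:R * (C / r * D').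
have e0 : 0 <= e by rewrite !mulr_ge0// invr_ge0 ltW.
have Hg E : gamma (z E) <= gamma (w E) + e.
  rewrite zw.
  have -> : shift_mx (y E) = \sum_(k <- enum 'I_n) shift_along k (y E 0 k).
    rewrite big_enum/=; apply/matrixP => i k; rewrite summxE (bigD1 k)//= shift_alongE eqxx mulr1.
    by rewrite big1 ?addr0 ?mxE// => k' k'k; rewrite shift_alongE eq_sym (negbTE k'k) mulr0.
  have -> : e = \sum_(k <- enum 'I_n) (C / r * D').
    by rewrite /e big_enum/= sumr_const card_ord mulr_natl.
  elim: (enum 'I_n) (w E) lg => [|k l IH] x lg'; first by rewrite !big_nil !addr0.
  rewrite !big_cons addrA; apply: le_trans (IH _ _) _.
    by move=> k' k'l; apply: lg'; rewrite inE k'l orbT.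
  rewrite addrA lerD2r; apply: le_trans (lg' k (mem_head _ _) _ _) _.
  by rewrite lerD2l ler_wpM2l ?yD'// divr_ge0// ltW.
have g0 x : 0 <= gamma x by have /andP[] := hg.2 x.
have mg (u : T -> V) : (forall i k, measurable_fun [set: T] (fun t => u t i k)) ->
    measurable_fun [set: T] (fun t => (gamma (u t))%:E).
  move=> mu; apply/measurable_EFinP.
  under eq_fun do rewrite -[u _]addr0.
  exact: (measurable_test_shift 0 mu hg).
have I1 : (\int[nu]_E (gamma (z E))%:E <= \int[nu]_E (gamma (w E))%:E + (e * m)%:E)%E.
  rewrite EFinM -nuT -[X in (_ + X)%E](integral_cst nu measurableT).
  rewrite -ge0_integralD//; last 2 first.
  - by move=> E _; rewrite lee_fin.
  - exact: mg.
  by apply: le_integral_nonmeasurable => E; rewrite ?lee_fin// -EFinD lee_fin.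
have shift0 : shift_mx 0 = 0 :> V by apply/matrixP => i k; rewrite !mxE.
have := gg 0; rewrite shift0.
under eq_integral do rewrite addr0.
under [X in (_ <= X)%E]eq_integral do rewrite addr0.
move=> /le_trans/(_ I1).
have fin : ((\int[nu]_E (gamma (w E))%:E)%E \is a fin_num).
  rewrite ge0_fin_numE; last by apply: integral_ge0 => E _; rewrite lee_fin.
  apply: (@le_lt_trans _ _ (\int[nu]_E (cst C%:E E))%E).
    apply: le_integral_nonmeasurable => E; rewrite lee_fin//.
    by have /andP[] := hg.2 (w E).
  by rewrite integral_cst// [X in (_ * X)%E]nuT -EFinM ltry.
rewrite -(fineK fin) -!EFinD lee_fin addrC lerD2l leNgt => /negP; apply.
rewrite /e /r invf_div; set q := n%:R * (C * D') * m.
have q0 : 0 <= q by rewrite !mulr_ge0.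
have -> : n%:R * (C * (c / (q + 1)) * D') * m = q * c / (q + 1) by rewrite /q; ring.
by rewrite ltr_pdivrMr ?ltr_wpDl// mulrC ltr_pM2l// ltrDl.
Qed.

End iterated_average.
End averaging.

(** Integrals over D become integrals over the whole space for a finite measure, the form in which
    the averaging argument is stated. *)
Lemma integral_mfrestr d (T : measurableType d) (R : realType)
    (mu : {measure set T -> \bar R}) (D : set T) (mD : measurable D)
    (moo : (mu D < +oo)%E) (f : T -> R) (C : R) :
  measurable_fun [set: T] f -> (forall t, 0 <= f t <= C) ->
  (\int[mfrestr mD moo]_t (f t)%:E = \int[mu]_(t in D) (f t)%:E)%E.
Proof.
move=> mf fC.
have fi : (mfrestr mD moo).-integrable [set: T] (EFin \o f).
  apply: measurable_bounded_integrable => //; first exact: fin_num_fun_lty.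
  exists C; split=> [|M M1 t _]; first exact: num_real.
  by have /andP[f0 f1] := fC t; rewrite /= ger0_norm// (le_trans f1)// ltW.
rewrite (@negligible_integral _ _ _ (mfrestr mD moo) setT (~` D))//.
- rewrite setTD setCK; apply: eq_measure_integral => A mA AD.
  by rewrite /= /mfrestr /mrestr setIidl.
- exact: measurableC.
- by rewrite /= /mfrestr /mrestr setICl measure0.
Qed.

(** * The Crofton formula *)

Section crofton.
Variables (R : realType) (n s : nat).
Variable mu : {measure set (line_borel R n) -> \bar R}.
Variable Lam : convex_body R n.+1 -> 'I_n.+1 ->
  {measure set (borel ('rV[R]_n.+1 * 'rV[R]_n.+1)%type) -> \bar R}.
Variable alpha : convex_body R n.+1 -> symtensor R n.+1 s.
Hypothesis hmu : is_invariant_line_measure mu.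
Hypothesis crof : surface_crofton mu Lam alpha.
Variables (K : convex_body R n.+1) (i : 'I_s -> 'I_n.+1).

Let a (L : convex_body R n.+1) : R := tensor_coord (alpha L) i.

(** Substituting E + x for E in the identity for K + x replaces the chord of K + x by the translated
    chord of K, so that all translates are integrated over the same chords. *)
Lemma crofton_translate x :
  let f (E : line_borel R n) := a (translate (cap_line K E) x) in
  mu.-integrable [set: line_borel R n] (EFin \o f) /\
  (\int[mu]_E (f E)%:E)%E = (surface_tensor_coord Lam (translate K x) i)%:E.
Proof.
move=> f; have [fi fE] := crof (translate K x) i.
have h1 : (1 : R) * 1 = 1 by rewrite mulr1.
have QQ := @homothety_orthogonal R n 1 h1.
have ff : (fun E => a (cap_line (translate K x) E)) \o move_line x QQ = f.
  by apply/funext => E; rewrite /= cap_translate.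
split; first by rewrite -ff; exact: integrable_move.
by rewrite -fE -(integral_move hmu QQ x h1 fi) -ff.
Qed.

Lemma crofton_flip x :
  let f (E : line_borel R n) := a (translate (flip (cap_line K E)) x) in
  mu.-integrable [set: line_borel R n] (EFin \o f) /\
  (\int[mu]_E (f E)%:E)%E = (surface_tensor_coord Lam (translate (flip K) x) i)%:E.
Proof.
move=> f; have [fi fE] := crof (translate (flip K) x) i.
have h1 : (-1 : R) * -1 = 1 by rewrite mulrNN mulr1.
have QQ := @homothety_orthogonal R n (-1) h1.
have ff : (fun E => a (cap_line (translate (flip K) x) E)) \o move_line x QQ = f.
  by apply/funext => E; rewrite /= cap_flip.
split; first by rewrite -ff; exact: integrable_move.
by rewrite -fE -(integral_move hmu QQ x h1 fi) -ff.
Qed.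

Lemma cap_line_empty E : ~ hits K E -> cap_line K E = @empty_body R n.+1.
Proof.
move=> nE; apply: convex_body_ext; rewrite -subset0 => x [Kx Ex].
by apply: nE; exists x.
Qed.

Lemma translate_empty x : translate (@empty_body R n.+1) x = @empty_body R n.+1.
Proof. by apply: convex_body_ext; rewrite -subset0 => _ [y []]. Qed.

Lemma flip_empty : flip (@empty_body R n.+1) = @empty_body R n.+1.
Proof. by apply: convex_body_ext; rewrite -subset0 => _ [y []]. Qed.

Lemma flip_cap_line E : exists y, flip (cap_line K E) = translate (cap_line K E) y.
Proof.
have [hE|nE] := pselect (hits K E); last first.
  by exists 0; rewrite cap_line_empty// flip_empty translate_empty.
(* The translation vector, minus the sum of the two end points, is supplied by unification. *)
eexists; rewrite cap_line_seg// flip_seg -seg_swap swap_rows_opp translate_seg; reflexivity.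
Qed.

Lemma crofton_translation_invariant : translation_invariant alpha ->
  surface_tensor_coord Lam (translate K 0) i =
  surface_tensor_coord Lam (translate (flip K) 0) i.
Proof.
move=> ti; apply: EFin_inj.
have [_ <-] := crofton_translate 0; have [_ <-] := crofton_flip 0.
apply: eq_integral => E _; have [y ->] := flip_cap_line E.
by rewrite /a !ti.
Qed.

Section bounded.
Hypothesis balpha : bounded_tensor_fun alpha.
Hypothesis malpha : measurable_tensor_fun alpha.
Hypothesis Kbox : forall x, body_set K x -> forall j, `|x 0 j| <= 1.
Hypothesis hitsK : (mu (hits K) < +oo)%E.

Let mH : measurable (hits K).
Proof. by apply: measurable_hits; exact: body_compact. Qed.

Let nu : {finite_measure set (line_borel R n) -> \bar R} := mfrestr mH hitsK.

(** The default 0 of [chord_sup] extends the bound to lines that miss K, as the averaging argument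
    asks for it at every E. *)
Lemma endpoints_le1 E r j : `|endpoints K E r j| <= 1.
Proof.
have top1 (sg : R) : `|sg| <= 1 -> `|chord_sup K sg j E| <= 1.
  move=> sg1; have [hE|nE] := pselect (hits K E); last first.
    by rewrite chord_sup_miss// normr0.
  have [x [Kx _] [-> _]] := chord_sup_attained sg j hE.
  by rewrite normrM mulr_ile1// Kbox.
by rewrite mxE; case: ifP => _; rewrite ?normrN top1// ?normrN normr1.
Qed.

(** Instance of [bounded_shift_gap]: over the lines that hit K, z codes the chord and w the
    reflected chord, and they differ by a translation bounded by 2 in each coordinate. *)
Lemma crofton_bounded_gap c : 0 <= c ->
  (forall x, c <= surface_tensor_coord Lam (translate K x) i
                - surface_tensor_coord Lam (translate (flip K) x) i) -> c = 0.
Proof.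
move=> c0 H; have [C HC] := balpha.
have aC L : `|a L| <= C by exact: HC.
(* Adding C makes the function nonnegative; over the lines hitting K it adds the same finite amount
   to both integrals. *)
pose beta (z : 'M[R]_(2, n.+1)) := a (seg z) + C.
have beta_bounds z : 0 <= beta z <= 2 * C.
  by have := aC (seg z); rewrite ler_norml /beta => /andP[? ?]; apply/andP; split; lra.
have mbeta : measurable_fun [set: borel 'M[R]_(2, n.+1)]
    (beta : borel 'M[R]_(2, n.+1) -> R).
  apply: measurable_funD => //.
  exact: (measurableT_comp (malpha i) (@measurable_seg R n.+1)).
have hb : bounded_test_fun (2 * C) beta by split.
pose z (E : line_borel R n) := endpoints K E.
(* Swapping the rows leaves the reflected segment unchanged as a set, but makes its code a translate
   of z. *)
pose w (E : line_borel R n) := swap_rows (- z E).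
have mz r j : measurable_fun [set: line_borel R n] (fun E => z E r j).
  exact: measurable_endpoints.
have mw r j : measurable_fun [set: line_borel R n] (fun E => w E r j).
  rewrite (_ : (fun _ => _) = fun E => - z E (rev_ord r) j).
    by apply: measurable_funN; exact: mz.
  by apply/funext => E; rewrite /w !mxE.
pose y E := row ord0 (z E) + row ord_max (z E).
apply: (@bounded_shift_gap R n.+1 _ (line_borel R n) nu z w (2 * C) c mz mw c0 beta y 2) => //.
- move=> v.
  pose F (E : line_borel R n) : R := a (translate (cap_line K E) v).
  pose G (E : line_borel R n) : R := a (translate (flip (cap_line K E)) v).
  have [Fi FE] : mu.-integrable setT (EFin \o F) /\ _ := crofton_translate v.
  have [Gi GE] : mu.-integrable setT (EFin \o G) /\ _ := crofton_flip v.
  have split_int (f : line_borel R n -> R) : mu.-integrable setT (EFin \o f) ->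
      \int[mu]_E f E = \int[mu]_(E in hits K) f E + \int[mu]_(E in ~` hits K) f E.
    move=> fi; rewrite -Rintegral_setU ?setUCr//; first exact: measurableC.
    exact/disj_setPCl.
  (* Both chords are empty here; only the integrals over lines that hit K can differ. *)
  have outside : \int[mu]_(E in ~` hits K) F E = \int[mu]_(E in ~` hits K) G E.
    apply: eq_Rintegral => E /set_mem nE.
    by rewrite /F /G cap_line_empty// flip_empty.
  have cH : c <= \int[mu]_(E in hits K) F E - \int[mu]_(E in hits K) G E.
    have := H v; have <- : \int[mu]_E F E = surface_tensor_coord Lam (translate K v) i.
      by rewrite /Rintegral FE.
    have <- : \int[mu]_E G E = surface_tensor_coord Lam (translate (flip K) v) i.
      by rewrite /Rintegral GE.
    by rewrite !split_int// outside opprD addrACA subrr addr0.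
  have hits_int (u : line_borel R n -> 'M[R]_(2, n.+1)) (f : line_borel R n -> R) :
      (forall r j, measurable_fun [set: line_borel R n] (fun E => u E r j)) ->
      mu.-integrable setT (EFin \o f) ->
      (forall E, hits K E -> a (seg (u E + shift_mx v)) = f E) ->
      (\int[nu]_E (beta (u E + shift_mx v))%:E =
        (\int[mu]_(E in hits K) f E + C * fine (mu (hits K)))%:E)%E.
    move=> mu' fi uf; rewrite (@integral_mfrestr _ _ R mu _ mH hitsK
      (fun E => beta (u E + shift_mx v)) (2 * C))//; last first.
      exact: (measurable_test_shift (shift_mx v) mu' hb).
    have fiH : mu.-integrable (hits K) (EFin \o f).
      exact: (integrableS measurableT mH _ fi).
    have ciH : mu.-integrable (hits K) (EFin \o cst C).
      by apply: measurable_bounded_integrable => //; exact: bounded_cst.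
    rewrite -(Rintegral_cst mu mH C) -RintegralD//.
    rewrite /Rintegral fineK; last first.
      apply: integrable_fin_num => //.
      exact: (@integrableD _ _ _ mu _ mH _ _ fiH ciH).
    by apply: eq_integral => E /set_mem hE; rewrite /beta uf.
  rewrite (hits_int w G mw Gi); last first.
    by move=> E hE; rewrite /G cap_line_seg// flip_seg -translate_seg seg_swap.
  rewrite (hits_int z F mz Fi); last first.
    by move=> E hE; rewrite /F cap_line_seg// translate_seg.
  rewrite -EFinD lee_fin; lra.
- by move=> E; rewrite /w swap_rows_opp -addrA; apply/matrixP => r j; rewrite !mxE; ring.
- move=> E j; have -> : y E 0 j = z E ord0 j + z E ord_max j by rewrite /y !mxE.
  apply: le_trans (ler_normD _ _) _.
  by have := endpoints_le1 E ord0 j; have := endpoints_le1 E ord_max j; rewrite /z; lra.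
Qed.

End bounded.
End crofton.

Lemma eball_compact (R : realType) n (r : R) : compact (@eball R n r).
Proof.
have cB : compact [set x : 'rV[R]_n | forall j, `[- r, r]%classic (x ord0 j)].
  by apply: (@rV_compact _ _ (fun=> `[- r, r]%classic)) => _; exact: segment_compact.
apply: subclosed_compact cB _.
  apply: (@preimage_closed _ _ (@enorm R n) [set t | t <= r]) => [x _|].
    exact: continuous_enorm.
  exact: closed_le.
move=> x xr j; rewrite /= in_itv/= -ler_norml.
exact: le_trans (coord_le_enorm x j) xr.
Qed.

(** The normalization of [mu] on the unit ball is the only source of finiteness, so the body is kept
    inside that ball. *)
Lemma hits_finite (R : realType) n (mu : {measure set (line_borel R n) -> \bar R})
    (K : convex_body R n.+1) :
  is_invariant_line_measure mu -> K `<=` eball 1 -> (mu (hits K) < +oo)%E.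
Proof.
move=> [_ muB] KB; apply: (@le_lt_trans _ _ (kappa R n)%:E); last exact: ltry.
rewrite -muB; apply: le_measure; rewrite ?inE.
- by apply: measurable_hits; exact: body_compact.
- by apply: measurable_hits; exact: eball_compact.
by move=> E [x [Ex Kx]]; exists x; split => //; exact: KB.
Qed.

(* The dimension is n + 2, with n arbitrary. *)
Theorem theorem3p6 (R : realType) (n s : nat)
    (mu : {measure set (line_borel R n.+1) -> \bar R})
    (Lam : convex_body R n.+2 -> 'I_n.+2 ->
       {measure set (borel ('rV[R]_n.+2 * 'rV[R]_n.+2)%type) -> \bar R}) :
  (1 < s)%N -> odd s ->
  is_invariant_line_measure mu ->
  is_support_measures Lam ->
  ~ (exists alpha : convex_body R n.+2 -> symtensor R n.+2 s,
       translation_invariant alpha /\ surface_crofton mu Lam alpha) /\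
  ~ (exists alpha : convex_body R n.+2 -> symtensor R n.+2 s,
       bounded_tensor_fun alpha /\ measurable_tensor_fun alpha /\
       surface_crofton mu Lam alpha).
Proof.
move=> s1 sodd hmu hLam.
(* The norm of a point of the prism is at most (n + 2) h, so h = 1 / (n + 2) puts the prism into the
   unit ball. *)
have [h h0 nh] : exists2 h : R, 0 < h & n.+2%:R * h <= 1.
  by exists n.+2%:R^-1; rewrite ?invr_gt0// mulfV.
have h1 : h <= 1.
  by apply: le_trans nh; rewrite ler_peMl ?ler1n// ltW.
have [c c0 gap] := surface_tensor_gap s1 sodd hLam h0.
have Kbox x : body_set (prism n h) x -> forall j, `|x 0 j| <= h.
  by move=> [xb _] j; have /andP[x0 xh] := xb j; rewrite ger0_norm.
split=> [[alpha [ti crof]]|[alpha [balpha [malpha crof]]]].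
  have := gap 0; rewrite (crofton_translation_invariant hmu crof)// subrr.
  by rewrite leNgt c0.
have /eqP := crofton_bounded_gap hmu crof balpha malpha
  (fun x Kx j => le_trans (Kbox x Kx j) h1)
  (hits_finite hmu (fun x Kx => le_trans (enorm_le_sum (ltW h0) (Kbox x Kx)) nh))
  (ltW c0) gap.
by rewrite gt_eqF.
Qed.
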